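(* Let $\pi\colon X\to(\mathbb{P}^1)^n$ be a finite abelian cover with $X$ smooth and Galois group $G$, and let $m\ge1$. For $\chi\in\operatorname{Irr}(G)$ write $(\pi_*K_X^{\otimes m})^\chi=\mathcal{O}_{(\mathbb{P}^1)^n}(r^1_{m,\chi},\dots,r^n_{m,\chi})$ with $r^j_{m,\chi}\in\mathbb{Z}$. Assume that the following conditions hold: (a) for all $h\in G\setminus\{1_G\}$ there exist irreducible constituents $\chi,\chi'$ of $\chi_m$ such that $\chi(h)\ne\chi'(h)$; (b) for every $j=1,\dots,n$ there exists an irreducible constituent $\chi$ of $\chi_m$ such that $r^j_{m,\chi}\ge1$. Then the $m$-canonical map $\Phi_m$ of $X$ is birational.
   Context: Everything is over $\mathbb{C}$. A finite abelian cover $\pi\colon X\to Y$ with Galois group $G$ is a finite morphism which is the quotient by a faithful action of the finite abelian group $G$ on $X$; $X$ is connected. The $m$-canonical map is $\Phi_m\colon X\dashrightarrow\mathbb{P}(H^0(X,K_X^{\otimes m})^\vee)$, defined by $|K_X^{\otimes m}|$; birational means birational onto its image. $\chi_m$ is the character of the $m$-canonical representation $\rho_m\colon G\to\operatorname{GL}(H^0(X,K_X^{\otimes m}))$, $\rho_m(g)(\omega)=g^*\omega$. For $\chi\in\operatorname{Irr}(G)$, $(\pi_*K_X^{\otimes m})^\chi$ is the line bundle on $Y$ whose sections over $U$ are the $\omega\in K_X^{\otimes m}(\pi^{-1}(U))$ with $g^*\omega=\chi(g)\omega$ for all $g\in G$. A character $\chi$ is an irreducible constituent of $\chi_m$ if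 and only if $r^j_{m,\chi}\ge0$ for all $j$. *)

(* Defs.v *)
From HB Require Import structures.
From mathcomp Require Import all_boot all_order all_algebra all_fingroup.
From mathcomp Require Import all_character.
From mathcomp Require Import all_classical all_reals topology complex.
From mathcomp Require mpoly.
Import (canonicals) mpoly.

Set Implicit Arguments.
Unset Strict Implicit.
Unset Printing Implicit Defensive.

Import Order.TTheory GRing.Theory Num.Theory.
Local Open Scope classical_set_scope.
Local Open Scope ring_scope.

(** * Spaces with functions

    Classical (reduced) varieties over K, which is meant to be algebraically
    closed: a topological space together with a sheaf of K-valued functions.
    Functions are total; their values outside the open set under
    consideration are irrelevant.  The single axiom (whose converse is
    trivial) says that regularity is a local condition which only depends on
    the values on U; it contains restriction and gluing.  That the regular
    functions form rings is part of being locally affine, see [variety]. *)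

Record funspace (K : fieldType) := FunSpace {
  carrier :> topologicalType;
  regular : set carrier -> (carrier -> K) -> Prop;
  regular_local : forall U f, open U ->
    (forall x, U x -> exists V g, [/\ open V, V x, regular V g &
      forall y, U y -> V y -> f y = g y]) ->
    regular U f }.

(** Spaces described by coordinate vectors: [coord x v] says that [v] is a
    coordinate vector of the point [x] (unique for affine space, unique up to
    scaling for projective spaces). *)

Definition peval (K : fieldType) (N : nat) (p : mpoly.mpoly N K)
  (v : 'rV[K]_N) : K := mpoly.meval (fun i => v 0 i) p.

Definition coord_open (K : fieldType) (N : nat) (T : Type)
  (coord : T -> 'rV[K]_N -> Prop) (U : set T) : Prop :=
  forall x v, U x -> coord x v -> exists p : mpoly.mpoly N K,
    peval p v != 0 /\
    forall y w, coord y w -> peval p w != 0 -> U y.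

(** [F] is locally a quotient of two polynomials in the coordinates. *)
Definition coord_regular (K : fieldType) (N : nat) (T : Type)
  (coord : T -> 'rV[K]_N -> Prop) (U : set T) (F : T -> 'rV[K]_N -> K)
  : Prop :=
  forall x v, U x -> coord x v -> exists p q : mpoly.mpoly N K,
    peval q v != 0 /\
    forall y w, U y -> coord y w -> peval q w != 0 ->
      F y w = peval p w / peval q w.

Lemma coord_openT (K : fieldType) (N : nat) (T : Type)
  (coord : T -> 'rV[K]_N -> Prop) :
  coord_open coord setT.
Proof.
by move=> x v _ _; exists 1; rewrite /peval mpoly.meval1 oner_eq0.
Qed.

Lemma coord_openI (K : fieldType) (N : nat) (T : Type)
  (coord : T -> 'rV[K]_N -> Prop) :
  setI_closed (coord_open coord).
Proof.
move=> A B oA oB x v [Ax Bx] xv.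
have [p [pv pA]] := oA x v Ax xv; have [q [qv qB]] := oB x v Bx xv.
exists (p * q); rewrite /peval mpoly.mevalM mulf_neq0//; split=> // y w yw.
by rewrite mpoly.mevalM mulf_eq0 negb_or => /andP[pw qw]; split;
  [exact: pA yw pw | exact: qB yw qw].
Qed.

Lemma coord_open_bigU (K : fieldType) (N : nat) (T : Type)
  (coord : T -> 'rV[K]_N -> Prop) (I : Type) (f : I -> set T) :
  (forall i, coord_open coord (f i)) -> coord_open coord (\bigcup_i f i).
Proof.
move=> of_ x v [i _ fx] xv; have [p [pv pf]] := of_ i x v fx xv.
by exists p; split=> // y w yw pw; exists i => //; exact: pf yw pw.
Qed.

Lemma coord_regular_local (K : fieldType) (N : nat) (T : Type)
  (coord : T -> 'rV[K]_N -> Prop) (U : set T) (f : T -> K) :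
  (forall x, U x -> exists V g, [/\ coord_open coord V, V x,
      coord_regular coord V (fun y _ => g y) &
      forall y, U y -> V y -> f y = g y]) ->
  coord_regular coord U (fun y _ => f y).
Proof.
move=> fU x v Ux xv; have [V [g [oV Vx rg fg]]] := fU x Ux.
have [p [q [qv gE]]] := rg x v Vx xv; have [t [tv tV]] := oV x v Vx xv.
exists (p * t), (q * t); rewrite /peval !mpoly.mevalM mulf_neq0//.
split=> // y w Uy yw; rewrite !mpoly.mevalM mulf_eq0 negb_or => /andP[qw tw].
have Vy := tV y w yw tw.
by rewrite fg// (gE y w)// /peval -mulf_div divff// mulr1.
Qed.

(** Affine space K^N with its Zariski topology and its regular functions. *)

Definition affine_point (K : fieldType) (N : nat) := 'rV[K]_N.
HB.instance Definition _ K N := Choice.on (affine_point K N).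

Definition affine_coord (K : fieldType) (N : nat) (x : affine_point K N)
  (v : 'rV[K]_N) : Prop := v = x.

HB.instance Definition _ (K : fieldType) N :=
  @isOpenTopological.Build (affine_point K N)
    (coord_open (@affine_coord K N)) (@coord_openT _ _ _ _)
    (@coord_openI _ _ _ _) (@coord_open_bigU _ _ _ _).

Definition affine_space (K : fieldType) (N : nat) : funspace K :=
  @FunSpace K (affine_point K N)
    (fun U f => coord_regular (@affine_coord K N) U (fun x _ => f x))
    (fun U f _ => @coord_regular_local K N _ _ U f).

(** The multiprojective space (P^e)^n, a point of P^e being a line in
    K^(e+1).  A system of homogeneous coordinates of a point is an
    n x (e+1) matrix whose j-th row spans the j-th line; it is unique up to
    independent rescaling of the rows. *)

Definition multiproj_point (K : fieldType) (n e : nat) :=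
  {ffun 'I_n -> {L : {vspace 'rV[K]_e.+1} | \dim L == 1%N}}.
HB.instance Definition _ K n e := Choice.on (multiproj_point K n e).

Definition homog_coord (K : fieldType) (n e : nat)
  (x : multiproj_point K n e) (A : 'M[K]_(n, e.+1)) : Prop :=
  forall j, row j A != 0 /\ row j A \in val (x j).

Definition multiproj_coord (K : fieldType) (n e : nat)
  (x : multiproj_point K n e) (v : 'rV[K]_(n * e.+1)) : Prop :=
  homog_coord x (vec_mx v).

HB.instance Definition _ (K : fieldType) n e :=
  @isOpenTopological.Build (multiproj_point K n e)
    (coord_open (@multiproj_coord K n e)) (@coord_openT _ _ _ _)
    (@coord_openI _ _ _ _) (@coord_open_bigU _ _ _ _).

Definition multiproj (K : fieldType) (n e : nat) : funspace K :=
  @FunSpace K (multiproj_point K n e)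
    (fun U f => coord_regular (@multiproj_coord K n e) U (fun x _ => f x))
    (fun U f _ => @coord_regular_local K _ _ _ U f).

Definition P1n (K : fieldType) (n : nat) : funspace K := multiproj K n 1.
Definition projective_space (K : fieldType) (e : nat) : funspace K :=
  multiproj K 1 e.

(** Sections of O(r_1, ..., r_n) over an open subset V of (P^1)^n: regular
    functions on the cone over V in (K^2 - 0)^n which are homogeneous of
    degree r_j in the j-th pair of variables. *)
Definition O_section (K : fieldType) (n : nat) (r : 'I_n -> int)
  (V : set (P1n K n)) (s : 'M[K]_(n, 2) -> K) : Prop :=
  coord_regular (@multiproj_coord K n 1) V (fun _ v => s (vec_mx v)) /\
  forall x A (t : 'I_n -> K), V x -> homog_coord x A ->
    (forall j, t j != 0) ->
    s (\matrix_(j, k) (t j * A j k)) = (\prod_j t j ^ r j) * s A.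

(** * Morphisms and varieties *)

(** The structure induced on a (locally closed) subset A. *)
Definition regular_along (K : fieldType) (X : funspace K) (A : set X)
  (f : X -> K) : Prop :=
  forall x, A x -> exists V g, [/\ open V, V x, @regular K X V g &
    forall y, A y -> V y -> f y = g y].

Definition morphism_on (K : fieldType) (X Y : funspace K) (A : set X)
  (f : X -> Y) : Prop :=
  {within A, continuous f} /\
  forall W h, open W -> @regular K Y W h ->
    regular_along (A `&` f @^-1` W) (h \o f).

Definition isomorphism_on (K : fieldType) (X Y : funspace K)
  (A : set X) (B : set Y) (f : X -> Y) : Prop :=
  exists g : Y -> X,
    [/\ forall x, A x -> B (f x) /\ g (f x) = x,
        forall y, B y -> A (g y) /\ f (g y) = y,
        morphism_on A f & morphism_on B g].

Definition affine (K : fieldType) (X : funspace K) (A : set X) : Prop :=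
  exists (N : nat) (Z : set (affine_space K N)) (f : X -> affine_space K N),
    closed Z /\ isomorphism_on A Z f.

Definition separated (K : fieldType) (X : funspace K) : Prop :=
  forall (N : nat) (Z : set (affine_space K N)) (f g : affine_space K N -> X),
    closed Z -> morphism_on Z f -> morphism_on Z g ->
    closed (Z `&` [set z | f z = g z]).

(** Varieties need not be irreducible. *)
Definition variety (K : fieldType) (X : funspace K) : Prop :=
  [/\ compact [set: X],
      forall x : X, exists U : set X, [/\ open U, U x & affine U] &
      separated X].

Definition finite_morphism (K : fieldType) (X Y : funspace K) (f : X -> Y)
  : Prop :=
  morphism_on setT f /\
  forall V : set Y, open V -> affine V ->
    affine (f @^-1` V) /\
    exists (k : nat) (b : 'I_k -> X -> K),
      (forall i, @regular K X (f @^-1` V) (b i)) /\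
      forall h, @regular K X (f @^-1` V) h ->
        exists c : 'I_k -> Y -> K,
          (forall i, @regular K Y V (c i)) /\
          forall x, V (f x) -> h x = \sum_i c i (f x) * b i x.

(** The group acts by automorphisms, faithfully, and f is the quotient of X
    by it: the fibres are the orbits, Y has the quotient topology, and its
    regular functions are the invariant regular functions of X.
    The library's actions are right actions, which is immaterial since the
    group is abelian. *)
Definition finite_abelian_cover (K : fieldType) (gT : finGroupType)
  (X Y : funspace K) (act : {action gT &-> X}) (f : X -> Y) : Prop :=
  [/\ abelian [set: gT]%SET, connected [set: X], finite_morphism f &
   [/\ forall g : gT, morphism_on (Y := X) setT (act^~ g),
       forall g : gT, (forall x : X, act x g = x) -> g = 1%g &
     [/\ forall y : Y, exists x : X, f x = y,
         forall x x' : X, f x = f x' <-> exists g : gT, x' = act x g,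
         forall V : set Y, open (f @^-1` V) -> open V &
         forall (V : set Y) (h : Y -> K), open V ->
           @regular K X (f @^-1` V) (h \o f) -> @regular K Y V h]]].

(** * Smoothness *)

Definition irreducible_set (T : topologicalType) (Z : set T) : Prop :=
  Z !=set0 /\ forall A B : set T, closed A -> closed B ->
    Z `<=` A `|` B -> Z `<=` A \/ Z `<=` B.

Definition chain_at (T : topologicalType) (x : T) (k : nat) : Prop :=
  exists Z : nat -> set T,
    (forall i, (i <= k)%N ->
       [/\ closed (Z i), irreducible_set (Z i) & Z i x]) /\
    (forall i, (i < k)%N -> Z i `<` Z i.+1).

(** The Krull dimension of the local ring at x is d. *)
Definition dim_at (T : topologicalType) (x : T) (d : nat) : Prop :=
  chain_at x d /\ forall k, chain_at x k -> (k <= d)%N.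

(** Tangent vectors at x are the derivations of the local ring at x.  They
    are applied to functions which are regular near x only, and two of them
    are identified if they agree on those. *)
Definition tvec (K : fieldType) (X : funspace K) := (X -> K) -> K.

Definition tangent (K : fieldType) (X : funspace K) (x : X) (D : tvec X)
  : Prop :=
  forall V (f g : X -> K), open V -> V x ->
    @regular K X V f -> @regular K X V g ->
    [/\ (forall y, V y -> f y = g y) -> D f = D g,
        forall c : K, D (fun y => c * f y + g y) = c * D f + D g &
        D (fun y => f y * g y) = f x * D g + g x * D f].

Definition tangent_dim (K : fieldType) (X : funspace K) (x : X) (d : nat)
  : Prop :=
  exists E : 'I_d -> tvec X, (forall i, tangent x (E i)) /\
    forall D, tangent x D -> exists! c : 'rV[K]_d,
      forall V f, open V -> V x -> @regular K X V f ->
        D f = \sum_i c 0 i * E i f.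

(** X is smooth, of pure dimension d. *)
Definition smooth (K : fieldType) (X : funspace K) (d : nat) : Prop :=
  forall x : X, dim_at x d /\ tangent_dim x d.

(** * Pluricanonical forms

    On a smooth X of dimension d, the fibre of K_X at x is the line of
    alternating d-forms on the tangent space, and eta_1 (x) ... (x) eta_m in
    the fibre of its m-th tensor power is identified with the function
    D |-> \prod_i eta_i(D) of d-tuples D of tangent vectors.  As K_X is locally
    generated by a form dg_1 /\ ... /\ dg_d with g_i regular, the sections of
    the m-th power are locally h (dg_1 /\ ... /\ dg_d)^m with h regular. *)

Definition form (K : fieldType) (X : funspace K) (d : nat) :=
  X -> ('I_d -> tvec X) -> K.

Definition form_eq (K : fieldType) (X : funspace K) (d : nat) (U : set X)
  (w w' : form X d) : Prop :=
  forall x D, U x -> (forall i, tangent x (D i)) -> w x D = w' x D.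

(** w is a section over U of the m-th power of the canonical bundle. *)
Definition pluriform (K : fieldType) (X : funspace K) (d m : nat)
  (U : set X) (w : form X d) : Prop :=
  forall x, U x -> exists V (h : X -> K) (g : 'I_d -> X -> K),
    [/\ open V, V x, @regular K X V h, forall i, @regular K X V (g i) &
        form_eq (U `&` V) w
          (fun y D => h y * \det (\matrix_(i, j) D j (g i)) ^+ m)].

Definition pullback (K : fieldType) (X : funspace K) (d : nat)
  (phi : X -> X) (w : form X d) : form X d :=
  fun x D => w (phi x) (fun i f => D i (f \o phi)).

Definition H0_basis (K : fieldType) (X : funspace K) (d m N : nat)
  (s : 'I_N -> form X d) : Prop :=
  (forall i, pluriform m setT (s i)) /\
  forall w : form X d, pluriform m setT w -> exists! c : 'rV[K]_N,
    form_eq setT w (fun x D => \sum_i c 0 i * s i x D).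

(** * Characters

    The library's characters take values in algC, here they take values
    in K. *)

Definition irr_char (K : fieldType) (gT : finGroupType) (chi : gT -> K)
  : Prop :=
  exists (k : nat) (rG : mx_representation K [set: gT]%G k),
    mx_irreducible rG /\ forall g, chi g = \tr (rG g).

Definition irr_constituent (K : numClosedFieldType) (gT : finGroupType)
  (phi chi : gT -> K) : Prop :=
  irr_char chi /\ #|gT|%:R^-1 * \sum_g phi g * (chi g)^* != 0.

(** phi is the character of g |-> g^* on the global pluricanonical forms. *)
Definition canonical_character (K : fieldType) (gT : finGroupType)
  (X : funspace K) (act : {action gT &-> X}) (d m : nat) (phi : gT -> K)
  : Prop :=
  exists (N : nat) (s : 'I_N -> form X d)
         (rG : mx_representation K [set: gT]%G N),
    [/\ H0_basis m s,
        forall g i, form_eq setT (pullback (act^~ g) (s i))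
                      (fun x D => \sum_j rG g i j * s j x D) &
        forall g, phi g = \tr (rG g)].

(** * Eigensheaves of the direct image of the pluricanonical sheaf *)

Definition eigensection (K : fieldType) (gT : finGroupType)
  (X Y : funspace K) (act : {action gT &-> X}) (f : X -> Y) (d m : nat)
  (chi : gT -> K) (V : set Y) (w : form X d) : Prop :=
  pluriform m (f @^-1` V) w /\
  forall g, form_eq (f @^-1` V) (pullback (act^~ g) w)
              (fun x D => chi g * w x D).

(** phi is an isomorphism from O(r) to the chi-eigensheaf, as sheaves of
    modules over the structure sheaf of (P^1)^n. *)
Record eigensheaf_iso (K : fieldType) (gT : finGroupType) (n : nat)
  (X : funspace K) (act : {action gT &-> X}) (f : X -> P1n K n) (d m : nat)
  (chi : gT -> K) (r : 'I_n -> int)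
  (phi : set (P1n K n) -> ('M[K]_(n, 2) -> K) -> form X d) : Prop := {
  iso_section : forall V s, open V -> O_section r V s ->
    eigensection act f m chi V (phi V s);
  iso_onto : forall V w, open V -> eigensection act f m chi V w ->
    exists s, O_section r V s /\ form_eq (f @^-1` V) (phi V s) w;
  iso_inj : forall V s s', open V -> O_section r V s -> O_section r V s' ->
    (form_eq (f @^-1` V) (phi V s) (phi V s') <->
     forall x A, V x -> homog_coord x A -> s A = s' A);
  iso_linear : forall V h s s' s'', open V -> @regular K (P1n K n) V h ->
    O_section r V s -> O_section r V s' -> O_section r V s'' ->
    (forall x A, V x -> homog_coord x A -> s'' A = h x * s A + s' A) ->
    form_eq (f @^-1` V) (phi V s'')
      (fun x D => h (f x) * phi V s x D + phi V s' x D);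
  iso_restrict : forall V V' s, open V -> open V' -> V' `<=` V ->
    O_section r V s -> form_eq (f @^-1` V') (phi V' s) (phi V s) }.

Definition eigensheaf_is_O (K : fieldType) (gT : finGroupType) (n : nat)
  (X : funspace K) (act : {action gT &-> X}) (f : X -> P1n K n) (d m : nat)
  (chi : gT -> K) (r : 'I_n -> int) : Prop :=
  exists phi, @eigensheaf_iso K gT n X act f d m chi r phi.

(** * Pluricanonical maps *)

(** p = [s_0(x) : ... : s_N(x)], the s_i(x) being compared by evaluating them
    on some tuple D of tangent vectors; by one-dimensionality of the fibre, p
    does not depend on D.  There is no such p if x is a base point. *)
Definition canonical_map (K : fieldType) (X : funspace K) (d N : nat)
  (s : 'I_N.+1 -> form X d) (x : X) (p : projective_space K N) : Prop :=
  exists D : 'I_d -> tvec X, (forall i, tangent x (D i)) /\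
    homog_coord p (\row_i s i x D).

(** The rational map Phi (given as a partial function) restricts to an
    isomorphism from a dense open subset of X onto an open subset of the
    closure of its image. *)
Definition birational_onto_image (K : fieldType) (X Y : funspace K)
  (Phi : X -> Y -> Prop) : Prop :=
  exists (U : set X) (f : X -> Y) (W : set Y),
    [/\ open U, dense U, forall x, U x -> Phi x (f x) &
     [/\ open W, f @` U = closure (f @` U) `&` W &
         isomorphism_on U (f @` U) f]].

(** The projective space of the dual of H^0 is identified with P^N by means
    of a basis of H^0. *)
Definition canonical_map_birational (K : fieldType) (X : funspace K)
  (d m : nat) : Prop :=
  exists (N : nat) (s : 'I_N.+1 -> form X d),
    H0_basis m s /\ birational_onto_image (canonical_map s).

(* Main.v *)
(** Over the chart of (P^1)^n where all first coordinates are non-zero, fix an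
    eigenform w_0.  Since X is smooth, the quotient of any pluricanonical form
    by w_0 is a regular function where w_0 does not vanish (Jacobian
    criterion), so that the zero loci of the eigenforms are closed and
    G-invariant.  Hence all eigenforms in (a) and (b) are invertible over some
    non-empty principal affine open set V of the chart, and U = pi^-1(V) is
    affine, G-invariant and dense.  If r^j_chi >= 1, then r^i_chi >= 0 for all
    i, because chi occurs in H^0, and two monomial sections of O(r_chi) with
    quotient the j-th affine coordinate are available; so the affine
    coordinates of (P^1)^n, and then all functions pulled back from V, are
    regular functions of the image point.  For a regular function G on U, the
    average of a(g) G(x g) over g is such a function for a = 1 because it is
    invariant, and this property of a weight a is stable under multiplication
    by chi / chi_0, since w_chi / w_0 is an eigenfunction.  By (a) products of
    the functions chi / chi_0 - const give a multiple of the characteristic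
    function of 1, so every regular function on U is a regular function of the
    image point.  Applied to the coordinates of the affine variety U this
    yields the inverse of the pluricanonical map on U. *)
Require Import Defs.
From mathcomp Require Import all_boot all_order all_algebra all_fingroup.
From mathcomp Require Import all_character.
From mathcomp Require Import all_classical all_reals topology complex.
From mathcomp Require mpoly.
From mathcomp Require Import ring.
Import (canonicals) mpoly.
Import Defs.

Set Implicit Arguments.
Unset Strict Implicit.
Unset Printing Implicit Defensive.

Import Order.TTheory GRing.Theory Num.Theory.
Local Open Scope classical_set_scope.
Local Open Scope ring_scope.

(** A pluricanonical form is presented near each point through functions [g i] of its own choice, so
    two forms can be compared only after the differentials are expressed in a common frame. This is
    what the Jacobian criterion supplies, and even closure of forms under addition rests on it.
    Since w_0 is a combination of the chosen basis of H^0, the quotients of the basis forms by w_0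
    are affine coordinates on a chart of projective space that contains the image of U. No function
    field of X is used: density comes from the irreducibility of (P^1)^n and the openness of the
    cover, and regularity on the image is checked near each image point. The image must also be
    closed in an open set. This holds because a limit of image points at which the coordinates of U
    extend regularly still satisfies the equations of U, hence is an image point. *)

Local Notation regularOn X := (@regular _ X).

(** * Regular functions and affine charts *)

(** Induction along the ring operations instead of monomials: regularity, the chain rule and
    restriction to a line are then checked on constants, variables, sums and products. *)
Lemma mpoly_ring_ind (K : comNzRingType) (N : nat)
  (Q : mpoly.mpoly N K -> Prop) :
  (forall c, Q (mpoly.mpolyC N c)) ->
  (forall i, Q (mpoly.mpolyX K (mpoly.mnm1 i))) ->
  (forall p q, Q p -> Q q -> Q (p + q)) ->
  (forall p q, Q p -> Q q -> Q (p * q)) -> forall p, Q p.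
Proof.
move=> QC QX QD QM p.
(* Substituting the variables into [p] displays it as a sum of constants times products of
   variables. *)
rewrite -[p]mpoly.comp_mpoly_id mpoly.comp_mpolyE.
apply: (big_ind Q); [by rewrite -mpoly.mpolyC0 | exact: QD |].
move=> m _; rewrite -mpoly.mul_mpolyC; apply: (QM); first exact: QC.
apply: (big_ind Q); [by rewrite -mpoly.mpolyC1 | exact: QM |].
move=> i _; elim: (mpoly.fun_of_multinom m i) => [|k IH].
  by rewrite expr0 -mpoly.mpolyC1.
by rewrite exprS; apply: QM => //; rewrite tnth_mktuple.
Qed.

Section FunctionSpaces.
Context {K : fieldType}.
Implicit Types X Y : funspace K.

Lemma regular_restrict X (U V : set X) f :
  open U -> open V -> V `<=` U -> regularOn X U f -> regularOn X V f.
Proof.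
by move=> oU oV VU rf; apply: regular_local => // x Vx; exists U, f; split=> //;
  apply: VU Vx.
Qed.

Lemma eq_regular X (U : set X) f g :
  open U -> (forall x, U x -> f x = g x) -> regularOn X U g -> regularOn X U f.
Proof.
by move=> oU fg rg; apply: regular_local => // x Ux; exists U, g;
  split=> // y Uy _; exact: fg.
Qed.

(** The axioms of [funspace] do not make regular functions a ring. *)
Definition ringed X : Prop :=
  [/\ forall (U : set X) c, open U -> regularOn X U (fun=> c),
      forall (U : set X) f g, open U -> regularOn X U f -> regularOn X U g ->
        regularOn X U (fun x => f x + g x),
      forall (U : set X) f g, open U -> regularOn X U f -> regularOn X U g ->
        regularOn X U (fun x => f x * g x) &
      forall (U : set X) f, open U -> regularOn X U f ->
        open (U `&` [set x | f x != 0]) /\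
        regularOn X (U `&` [set x | f x != 0]) (fun x => (f x)^-1)].

Lemma coord_ringed X (N : nat) (coord : X -> 'rV[K]_N -> Prop) :
  (forall U : set X, open U <-> coord_open coord U) ->
  (forall (U : set X) f,
     regularOn X U f <-> coord_regular coord U (fun x _ => f x)) ->
  (forall x, exists v, coord x v) -> ringed X.
Proof.
move=> openX regX coordX; split.
- move=> U c _; apply/regX => x v _ _; exists (mpoly.mpolyC N c), 1.
  rewrite /peval mpoly.meval1 oner_eq0; split=> // y w _ _ _.
  by rewrite mpoly.mevalC mpoly.meval1 divr1.
- move=> U f g _ /regX rf /regX rg; apply/regX => x v Ux xv.
  have [p [q [qv fE]]] := rf x v Ux xv.
  have [p' [q' [q'v gE]]] := rg x v Ux xv.
  exists (p * q' + p' * q), (q * q'); rewrite /peval mpoly.mevalM mulf_neq0//.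
  split=> // y w Uy yw.
  rewrite mpoly.mevalD !mpoly.mevalM mulf_eq0 negb_or => /andP[qw q'w].
  by rewrite (fE y w)// (gE y w)// addf_div.
- move=> U f g _ /regX rf /regX rg; apply/regX => x v Ux xv.
  have [p [q [qv fE]]] := rf x v Ux xv.
  have [p' [q' [q'v gE]]] := rg x v Ux xv.
  exists (p * p'), (q * q'); rewrite /peval mpoly.mevalM mulf_neq0//.
  split=> // y w Uy yw.
  rewrite !mpoly.mevalM mulf_eq0 negb_or => /andP[qw q'w].
  by rewrite (fE y w)// (gE y w)// mulf_div.
- move=> U f /openX oU /regX rf; split.
    apply/openX => x v [Ux fx] xv.
    have [p [q [qv fE]]] := rf x v Ux xv; have [o [ov oE]] := oU x v Ux xv.
    have pv : peval p v != 0.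
      by apply: contra_neq fx => pv; rewrite (fE x v)// pv mul0r.
    exists (o * p * q); rewrite /peval !mpoly.mevalM !mulf_neq0//.
    split=> // y w yw; rewrite !mpoly.mevalM !mulf_eq0 !negb_or.
    move=> /andP[/andP[ow pw] qw].
    have Uy := oE y w yw ow; split=> //=.
    by rewrite (fE y w)// mulf_neq0// invr_neq0.
  apply/regX => x v [Ux fx] xv.
  have [p [q [qv fE]]] := rf x v Ux xv.
  have pv : peval p v != 0.
    by apply: contra_neq fx => pv; rewrite (fE x v)// pv mul0r.
  (* The inverse q / p is expanded by q, because [f = p / q] is known only where [q] does not
     vanish. *)
  exists (q * q), (q * p); rewrite /peval !mpoly.mevalM !mulf_neq0//.
  split=> // y w [Uy fy] yw; rewrite mpoly.mevalM mulf_eq0 negb_or.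
  move=> /andP[qw pw]; rewrite (fE y w)// mpoly.mevalM invf_div.
  by rewrite -mulf_div divff// mul1r.
Qed.

Lemma affine_ringed N : ringed (affine_space K N).
Proof.
by apply: (@coord_ringed (affine_space K N) N (@affine_coord K N)) => // x;
  exists x.
Qed.

Lemma row_vline (e : nat) (L : {L : {vspace 'rV[K]_e} | \dim L == 1%N}) :
  exists u : 'rV[K]_e, u != 0 /\ val L = <[u]>%VS.
Proof.
have /eqP Ldim := valP L.
have L0 : val L != 0%VS by rewrite -dimv_eq0 Ldim.
exists (vpick (val L)); rewrite vpick0; split=> //.
by apply/esym/eqP; rewrite eqEdim -memvE memv_pick Ldim dim_vline vpick0 L0.
Qed.

Lemma homog_coord_exists n e (x : multiproj_point K n e) :
  exists A, homog_coord x A.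
Proof.
have /choice[F FE] := fun j => row_vline (x j).
exists (\matrix_j F j) => j; rewrite rowK; have [Fj ->] := FE j.
by rewrite Fj memv_line.
Qed.

Lemma multiproj_ringed n e : ringed (multiproj K n e).
Proof.
apply: (@coord_ringed (multiproj K n e) _ (@multiproj_coord K n e)) => // x.
have [A xA] := homog_coord_exists x.
by exists (mxvec A); rewrite /multiproj_coord mxvecK.
Qed.

Lemma homog_coord_inj n e (x y : multiproj_point K n e) A :
  homog_coord x A -> homog_coord y A -> x = y.
Proof.
move=> xA yA; apply/ffunP => j; apply/val_inj.
have [A0 xAj] := xA j; have [_ yAj] := yA j.
have [u [u0 xE]] := row_vline (x j); have [v [v0 yE]] := row_vline (y j).
move: xAj yAj; rewrite /= in xE yE *; rewrite xE yE.
move=> /vlineP[a aE] /vlineP[b bE].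
have a0 : a != 0 by apply: contra_neq A0 => a0; rewrite aE a0 scale0r.
have b0 : b != 0 by apply: contra_neq A0 => b0; rewrite bE b0 scale0r.
apply/eqP; rewrite eqEdim !dim_vline u0 v0 leqnn andbT -memvE.
apply/vlineP; exists (a^-1 * b).
by rewrite -scalerA -bE aE scalerA mulVf// scale1r.
Qed.

Lemma homog_coord_uniq n e (x : multiproj_point K n e) A B :
  homog_coord x A -> homog_coord x B ->
  exists t : 'I_n -> K, (forall j, t j != 0) /\
    B = \matrix_(j, k) (t j * A j k).
Proof.
move=> xA xB.
have /choice[t tE] : forall j, exists t, t != 0 /\ row j B = t *: row j A.
  move=> j; have [A0 xAj] := xA j; have [B0 xBj] := xB j.
  have [u [u0 xE]] := row_vline (x j).
  move: xAj xBj; rewrite xE => /vlineP[a aE] /vlineP[b bE].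
  have a0 : a != 0 by apply: contra_neq A0 => a0; rewrite aE a0 scale0r.
  have b0 : b != 0 by apply: contra_neq B0 => b0; rewrite bE b0 scale0r.
  exists (b / a); rewrite mulf_neq0 ?invr_neq0//; split=> //.
  by rewrite bE aE scalerA divfK.
exists t; split=> [j|]; first by have [] := tE j.
apply/matrixP => j k; have [_ /rowP/(_ k)] := tE j.
by rewrite !mxE.
Qed.

Lemma homog_coord_scale n e (x : multiproj_point K n e) A (t : 'I_n -> K) :
  homog_coord x A -> (forall j, t j != 0) ->
  homog_coord x (\matrix_(j, k) (t j * A j k)).
Proof.
move=> xA t0 j; have [A0 xAj] := xA j.
have -> : row j (\matrix_(j, k) (t j * A j k)) = t j *: row j A.
  by apply/rowP => k; rewrite !mxE.
by rewrite scaler_eq0 negb_or t0 A0; split=> //; exact: memvZ.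
Qed.

Lemma homog_point_exists n e (A : 'M[K]_(n, e.+1)) :
  (forall j, row j A != 0) -> exists x : multiproj_point K n e, homog_coord x A.
Proof.
move=> A0; have dimA j : \dim <[row j A]>%VS == 1%N by rewrite dim_vline A0.
exists [ffun j => exist (fun L : {vspace 'rV[K]_e.+1} => \dim L == 1%N)
  <[row j A]>%VS (dimA j)] => j.
by rewrite A0 ffunE /= memv_line.
Qed.

Section RingedSpaces.
Context {X : funspace K} (ringX : ringed X).
Implicit Types U V : set X.

Lemma regular_cst U c : open U -> regularOn X U (fun=> c).
Proof. by case: ringX => h _ _ _; exact: h. Qed.

Lemma regularD U f g : open U -> regularOn X U f -> regularOn X U g ->
  regularOn X U (fun x => f x + g x).
Proof. by case: ringX => _ h _ _; exact: h. Qed.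

Lemma regularM U f g : open U -> regularOn X U f -> regularOn X U g ->
  regularOn X U (fun x => f x * g x).
Proof. by case: ringX => _ _ h _; exact: h. Qed.

Lemma open_regular_neq0 U f : open U -> regularOn X U f ->
  open (U `&` [set x | f x != 0]).
Proof. by case: ringX => _ _ _ h oU rf; have [] := h U f oU rf. Qed.

Lemma regularV U f : open U -> regularOn X U f -> (forall x, U x -> f x != 0) ->
  regularOn X U (fun x => (f x)^-1).
Proof.
case: ringX => _ _ _ h oU rf f0; have [oD] := h U f oU rf.
by apply: regular_restrict => // x Ux; split=> //; exact: f0.
Qed.

Lemma regular_sum U (I : Type) (s : seq I) (f : I -> X -> K) : open U ->
  (forall i, regularOn X U (f i)) -> regularOn X U (fun x =>
    \sum_(i <- s) f i x).
Proof.
move=> oU rf; elim: s => [|i s IH].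
  by apply: (@eq_regular X U _ (fun=> 0)) (regular_cst _ oU) => // x _;
    rewrite big_nil.
by apply: (@eq_regular X U _ _ _ _ (regularD oU (rf i) IH)) => // x _;
  rewrite big_cons.
Qed.

Lemma regular_prod U (I : Type) (s : seq I) (f : I -> X -> K) : open U ->
  (forall i, regularOn X U (f i)) -> regularOn X U (fun x =>
    \prod_(i <- s) f i x).
Proof.
move=> oU rf; elim: s => [|i s IH].
  by apply: (@eq_regular X U _ (fun=> 1)) (regular_cst _ oU) => // x _;
    rewrite big_nil.
by apply: (@eq_regular X U _ _ _ _ (regularM oU (rf i) IH)) => // x _;
  rewrite big_cons.
Qed.

Lemma regular_peval U (N : nat) (f : X -> 'rV[K]_N) P : open U ->
  (forall i, regularOn X U (fun x => f x 0 i)) ->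
  regularOn X U (fun x => peval P (f x)).
Proof.
move=> oU rf; elim/mpoly_ring_ind: P => [c|i|p q rp rq|p q rp rq].
- by apply: (@eq_regular X U _ (fun=> c)) (regular_cst _ oU) => // x _;
    rewrite /peval mpoly.mevalC.
- by apply: (@eq_regular X U _ _ _ _ (rf i)) => // x _;
    rewrite /peval mpoly.mevalXU.
- by apply: (@eq_regular X U _ _ _ _ (regularD oU rp rq)) => // x _;
    rewrite /peval mpoly.mevalD.
- by apply: (@eq_regular X U _ _ _ _ (regularM oU rp rq)) => // x _;
    rewrite /peval mpoly.mevalM.
Qed.

Lemma regular_det U (N : nat) (f : X -> 'M[K]_N) : open U ->
  (forall i j, regularOn X U (fun x => f x i j)) ->
  regularOn X U (fun x => \det (f x)).
Proof.
move=> oU rf; rewrite /determinant; apply: regular_sum => // s.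
by apply: regularM => //; [exact: regular_cst | apply: regular_prod].
Qed.

Lemma regular_closure_eq0 (S W : set X) H p : open W -> regularOn X W H ->
  closure S p -> W p -> (forall x, S x -> W x -> H x = 0) -> H p = 0.
Proof.
move=> oW rH Sp Wp H0; apply/eqP/negPn/negP => Hp.
have [|x [Sx [Wx Hx]]] := Sp (W `&` [set x | H x != 0]).
  by apply: open_nbhs_nbhs; split=> //; exact: open_regular_neq0.
by move: Hx; rewrite /= H0// eqxx.
Qed.

End RingedSpaces.

Lemma within_continuous_preimage (S T : topologicalType) (A : set S)
  (f : S -> T) (W : set T) : {within A, continuous f} -> open W ->
  exists V, open V /\ forall x, A x -> V x <-> W (f x).
Proof.
move=> /continuousP cf /cf /open_subspaceP[V oV VE]; exists V; split=> // x Ax.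
have E : (V `&` A) x = (f @^-1` W `&` A) x by rewrite VE.
split=> h; first by have [] : (f @^-1` W `&` A) x by rewrite -E.
by have [] : (V `&` A) x by rewrite E.
Qed.

Lemma within_continuousI (S T : topologicalType) (A : set S) (f : S -> T) :
  (forall W x, open W -> A x -> W (f x) ->
     exists V, [/\ open V, V x & forall y, A y -> V y -> W (f y)]) ->
  {within A, continuous f}.
Proof.
move=> h; apply/continuousP => W oW; apply/open_subspaceP.
exists (\bigcup_(V in [set V | open V /\ forall y, A y -> V y -> W (f y)]) V).
  by apply: bigcup_open => V [].
apply/seteqP; split=> x [].
  by move=> [V [oV VW] Vx] Ax; split=> //; exact: VW.
move=> Wx Ax; split=> //; have [V [oV Vx VW]] := h W x oW Ax Wx.
by exists V.
Qed.

Lemma morphism_setT_open X Y (f : X -> Y) (W : set Y) :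
  morphism_on setT f -> open W -> open (f @^-1` W).
Proof.
move=> [cf _] /(within_continuous_preimage cf)[V [oV VE]].
by rewrite (_ : _ @^-1` _ = V)//; apply/seteqP; split=> x /VE; exact.
Qed.

Lemma morphism_setT_regular X Y (f : X -> Y) (W : set Y) h :
  morphism_on setT f -> open W -> regularOn Y W h ->
  regularOn X (f @^-1` W) (h \o f).
Proof.
move=> mf oW rh; apply: regular_local; first exact: morphism_setT_open.
move=> x Wx; have [|V [g [oV Vx rg gE]]] := mf.2 W h oW rh x; first by split.
by exists V, g; split=> // y Wy Vy; exact: gE.
Qed.

Lemma regular_along_regular X (U : set X) f :
  open U -> regular_along U f -> regularOn X U f.
Proof. by move=> oU; exact: regular_local. Qed.

(** [phi] restricts to an isomorphism from the open set [U] onto a closed subset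
    of affine space; its values outside [U] are irrelevant. *)
Record chart X (U : set X) (M : nat) (phi : X -> 'rV[K]_M) : Prop := {
  chart_open : open U;
  chart_frac : forall P Q,
    open (U `&` [set x | peval Q (phi x) != 0]) /\
    regularOn X (U `&` [set x | peval Q (phi x) != 0])
      (fun x => peval P (phi x) / peval Q (phi x));
  chart_regular : forall V F x, open V -> regularOn X V F -> U x -> V x ->
    exists P Q, peval Q (phi x) != 0 /\
      forall z, U z -> peval Q (phi z) != 0 ->
        V z /\ F z = peval P (phi z) / peval Q (phi z);
  chart_inj : forall x y, U x -> U y -> phi x = phi y -> x = y;
  chart_closed : forall v : 'rV[K]_M, (forall x, U x -> phi x <> v) ->
    exists P, peval P v != 0 /\ forall x, U x -> peval P (phi x) = 0 }.

Lemma affine_space_coord N U i : open U ->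
  regularOn (affine_space K N) U (fun v : 'rV[K]_N => v 0 i).
Proof.
move=> _ v _ _ ->; exists (mpoly.mpolyX K (mpoly.mnm1 i)), 1.
rewrite /peval mpoly.meval1 oner_eq0; split=> // y w _ -> _.
by rewrite mpoly.mevalXU mpoly.meval1 divr1.
Qed.

Lemma affine_space_frac N (P Q : mpoly.mpoly N K) :
  let W := [set v : affine_space K N | peval Q v != 0] in
  open W /\ regularOn (affine_space K N) W (fun v => peval P v / peval Q v).
Proof.
move=> W; have rpoly (R : mpoly.mpoly N K) V : open V ->
    regularOn (affine_space K N) V (peval R).
  move=> oV; apply: (@regular_peval _ (affine_ringed N) V _ id) => // i.
  exact: affine_space_coord.
have oW : open W.
  rewrite -[W]setTI.
  exact: (open_regular_neq0 (affine_ringed N) openT (rpoly Q _ openT)).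
split=> //; apply: (regularM (affine_ringed N)) => //; first exact: rpoly.
by apply: (regularV (affine_ringed N)) => //; exact: rpoly.
Qed.

(** That [f] is a morphism makes fractions in the coordinates regular; that its inverse is one turns
    regular functions into fractions; closedness of [Z] gives an equation excluding any point
    outside the image. *)
Lemma affine_chart X (U : set X) : open U -> affine U ->
  exists M (phi : X -> 'rV[K]_M), chart U phi.
Proof.
move=> oU [M [Z [f [cZ [g [fZ gU mf mg]]]]]]; exists M, f; split => //.
- move=> P Q; have [oW rW] := affine_space_frac P Q.
  have oD : open (U `&` [set x | peval Q (f x) != 0]).
    have [V [oV VE]] := within_continuous_preimage mf.1 oW.
    rewrite (_ : _ `&` _ = U `&` V); first exact: openI.
    by apply/seteqP; split=> x [Ux] => /(VE x Ux) h; split.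
  split=> //; apply: regular_along_regular => // x Dx.
  have [V [h [oV Vx rh hE]]] := mf.2 _ _ oW rW x Dx.
  by exists V, h; split.
- move=> V F x oV rF Ux Vx; have [Zfx gfx] := fZ x Ux.
  have [W' [oW' W'E]] := within_continuous_preimage mg.1 oV.
  have [|W [H [oW Wx rH HE]]] := mg.2 V F oV rF (f x).
    by split=> //=; rewrite gfx.
  have W'x : W' (f x) by apply/W'E => //; rewrite gfx.
  have [o [ox oE]] := oW _ _ Wx erefl.
  have [o' [o'x o'E]] := oW' _ _ W'x erefl.
  have [p [q [qx pqE]]] := rH _ _ Wx erefl.
  (* Expanding by [o * o'] makes a non-zero denominator force [f z] into [W] and [W'], so that one
     polynomial controls the domain as well as the value. *)
  exists (o * o' * p), (o * o' * q); rewrite /peval !mpoly.mevalM !mulf_neq0//.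
  split=> // z Uz; rewrite !mpoly.mevalM !mulf_eq0 !negb_or =>
    /andP[/andP[oz o'z] qz].
  have [Zfz gfz] := fZ z Uz.
  have Wz : W (f z) by exact: oE oz.
  have Vz : V z by rewrite -gfz; apply/W'E => //; exact: o'E o'z.
  rewrite -mulf_div divff ?mulf_neq0// mul1r; split=> //.
  rewrite -{1}gfz [F _]HE//; last by split=> //=; rewrite gfz.
  by rewrite (pqE (f z) (f z)).
- by move=> x y Ux Uy fxy; have [_ <-] := fZ x Ux; have [_ <-] := fZ y Uy;
    rewrite fxy.
- move=> v nv; have nZ : (~` Z) v.
    by move=> Zv; have [Ugv fgv] := gU v Zv; exact: nv fgv.
  have [P [Pv PE]] := (closed_openC cZ) v v nZ erefl.
  exists P; split=> // x Ux; apply/eqP/negPn/negP => Px.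
  by have [Zfx _] := fZ x Ux; exact: (PE (f x) (f x) erefl Px).
Qed.

Lemma chart_coord X (U : set X) M (phi : X -> 'rV[K]_M) i :
  chart U phi -> regularOn X U (fun x => phi x 0 i).
Proof.
move=> c; have [oD rD] := chart_frac c (mpoly.mpolyX K (mpoly.mnm1 i)) 1.
apply: (regular_restrict oD (chart_open c)).
  by move=> x Ux; split=> //=; rewrite /peval mpoly.meval1 oner_eq0.
apply: (eq_regular oD _ rD) => x _.
by rewrite /peval mpoly.mevalXU mpoly.meval1 divr1.
Qed.

Lemma locally_affine_ringed X :
  (forall x : X, exists U : set X, [/\ open U, U x & affine U]) -> ringed X.
Proof.
move=> affX.
have chartX x : exists U M (phi : X -> 'rV[K]_M), U x /\ chart U phi.
  have [U [oU Ux /(affine_chart oU)[M [phi c]]]] := affX x.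
  by exists U, M, phi.
(* Regularity may be tested by fractions in a chart around each point, which reduces every ring
   operation to the arithmetic of fractions. *)
have frac (U : set X) F : open U -> (forall x, U x -> forall V M (phi : X ->
  'rV[K]_M),
    V x -> chart V phi -> exists P Q, peval Q (phi x) != 0 /\
      forall z, U z -> V z -> peval Q (phi z) != 0 ->
        F z = peval P (phi z) / peval Q (phi z)) -> regularOn X U F.
  move=> oU h; apply: regular_local => // x Ux.
  have [V [M [phi [Vx c]]]] := chartX x.
  have [P [Q [Qx FE]]] := h x Ux V M phi Vx c.
  have [oD rD] := chart_frac c P Q.
  exists (V `&` [set x | peval Q (phi x) != 0]).
  exists (fun x => peval P (phi x) / peval Q (phi x)); split=> // z Uz [Vz Qz].
  exact: FE.
split.
- move=> U c oU; apply: frac => // x Ux V M phi Vx _.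
  exists (mpoly.mpolyC M c), 1; rewrite /peval mpoly.meval1 oner_eq0; split=>
    // z _ _ _.
  by rewrite mpoly.mevalC mpoly.meval1 divr1.
- move=> U f g oU rf rg; apply: frac => // x Ux V M phi Vx c.
  have [p [q [qv fE]]] := chart_regular c oU rf Vx Ux.
  have [p' [q' [q'v gE]]] := chart_regular c oU rg Vx Ux.
  exists (p * q' + p' * q), (q * q'); rewrite /peval mpoly.mevalM mulf_neq0//.
  split=> // z _ Vz.
  rewrite mpoly.mevalD !mpoly.mevalM mulf_eq0 negb_or => /andP[qw q'w].
  by rewrite (fE z Vz qw).2 (gE z Vz q'w).2 addf_div.
- move=> U f g oU rf rg; apply: frac => // x Ux V M phi Vx c.
  have [p [q [qv fE]]] := chart_regular c oU rf Vx Ux.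
  have [p' [q' [q'v gE]]] := chart_regular c oU rg Vx Ux.
  exists (p * p'), (q * q'); rewrite /peval mpoly.mevalM mulf_neq0//.
  split=> // z _ Vz.
  rewrite !mpoly.mevalM mulf_eq0 negb_or => /andP[qw q'w].
  by rewrite (fE z Vz qw).2 (gE z Vz q'w).2 mulf_div.
- move=> U f oU rf.
  have oD : open (U `&` [set x | f x != 0]).
    rewrite openE => x [Ux fx]; have [V [M [phi [Vx c]]]] := chartX x.
    have [p [q [qx fE]]] := chart_regular c oU rf Vx Ux.
    have px : peval p (phi x) != 0.
      apply: contra_neq (fx : f x != 0) => px.
      by rewrite (fE x Vx qx).2 px mul0r.
    have [oD _] := chart_frac c 1 (p * q).
    rewrite /interior nbhsE.
    exists (V `&` [set x | peval (p * q) (phi x) != 0]).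
      by split=> //; split=> //=; rewrite /peval mpoly.mevalM mulf_neq0.
    move=> z [Vz] /=; rewrite /peval mpoly.mevalM mulf_eq0 negb_or =>
      /andP[pz qz].
    by have [Uz fz] := fE z Vz qz; split=> //=; rewrite fz mulf_neq0//
      invr_neq0.
  split=> //; apply: frac => // x [Ux fx] V M phi Vx c.
  have [p [q [qx fE]]] := chart_regular c oU rf Vx Ux.
  have px : peval p (phi x) != 0.
    apply: contra_neq (fx : f x != 0) => px.
    by rewrite (fE x Vx qx).2 px mul0r.
  exists (q * q), (q * p); rewrite /peval !mpoly.mevalM !mulf_neq0//.
  split=> // z _ Vz; rewrite !mpoly.mevalM mulf_eq0 negb_or => /andP[qz pz].
  by rewrite (fE z Vz qz).2 invf_div -mulf_div divff// mul1r.
Qed.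

End FunctionSpaces.

(** * Tangent vectors *)

Section TangentVectors.
Context {K : fieldType} {X : funspace K} (ringX : ringed X).
Implicit Types (U V : set X) (D : tvec X).

Lemma eq_tangent x D V V' f g : tangent x D -> open V -> open V' ->
  V x -> V' x -> regularOn X V f -> regularOn X V' g ->
  (forall y, V y -> V' y -> f y = g y) -> D f = D g.
Proof.
move=> tD oV oV' Vx V'x rf rg fg; have oW := openI oV oV'.
have [||E _ _] := tD (V `&` V') f g oW (conj Vx V'x).
- by apply: regular_restrict rf => // y [].
- by apply: regular_restrict rg => // y [].
- by apply: E => y [Vy V'y]; exact: fg.
Qed.

Lemma tangent_linear x D V f g a : tangent x D -> open V -> V x ->
  regularOn X V f -> regularOn X V g ->
  D (fun y => a * f y + g y) = a * D f + D g.
Proof. by move=> tD oV Vx rf rg; have [_ h _] := tD V f g oV Vx rf rg. Qed.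

Lemma tangentM x D V f g : tangent x D -> open V -> V x ->
  regularOn X V f -> regularOn X V g ->
  D (fun y => f y * g y) = f x * D g + g x * D f.
Proof. by move=> tD oV Vx rf rg; have [_ _ h] := tD V f g oV Vx rf rg. Qed.

Lemma tangentD x D V f g : tangent x D -> open V -> V x ->
  regularOn X V f -> regularOn X V g ->
  D (fun y => f y + g y) = D f + D g.
Proof.
move=> tD oV Vx rf rg; have := tangent_linear 1 tD oV Vx rf rg;
  rewrite mul1r => <-.
by congr (D _); apply/funext => y; rewrite mul1r.
Qed.

Lemma tangent_cst x D a : tangent x D -> D (fun=> a) = 0.
Proof.
move=> tD; have r1 b := regular_cst ringX b (@openT X).
have D1 : D (fun=> 1) = 0.
  have := tangentM tD openT I (r1 1) (r1 1); rewrite !mul1r => /eqP.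
  by rewrite -subr_eq0 opprD addrA subrr add0r oppr_eq0 => /eqP.
have D0 : D (fun=> 0) = 0.
  have := tangentD tD openT I (r1 0) (r1 0); rewrite addr0 => /eqP.
  by rewrite -subr_eq0 opprD addrA subrr add0r oppr_eq0 => /eqP.
have := tangent_linear a tD openT I (r1 1) (r1 0).
by rewrite D1 D0 mulr0 addr0 mulr1 addr0.
Qed.

Lemma tangent_cst0 (x : X) : tangent x (fun=> 0 : K).
Proof. by move=> V f g _ _ _ _; split=> // *; rewrite !mulr0 addr0. Qed.

Definition grad (M : nat) (P : mpoly.mpoly M K) (v : 'rV[K]_M) : 'rV[K]_M :=
  \row_k peval (mpoly.mderiv k P) v.

(** The differential of P / Q at [v], by the quotient rule. *)
Definition frac_grad (M : nat) (P Q : mpoly.mpoly M K) (v : 'rV[K]_M) :=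
  (peval Q v)^-1 *: (grad P v - (peval P v / peval Q v) *: grad Q v).

Lemma gradC M a (v : 'rV[K]_M) : grad (mpoly.mpolyC M a) v = 0.
Proof. by apply/rowP => k; rewrite !mxE mpoly.mderivC /peval mpoly.meval0. Qed.

Lemma gradX M i (v : 'rV[K]_M) :
  grad (mpoly.mpolyX K (mpoly.mnm1 i)) v = delta_mx 0 i.
Proof.
apply/rowP => k; rewrite !mxE mpoly.mderivX /peval mpoly.mevalZ mpoly.mnm1E.
rewrite eq_sym; case: eqVneq => [->|_]; last by rewrite mul0r.
suff -> : mpoly.mnm_sub (mpoly.mnm1 i) (mpoly.mnm1 i) = mpoly.mnm0.
  by rewrite mpoly.mpolyX0 mpoly.meval1 mulr1.
by apply/mpoly.mnmP => j; rewrite mpoly.mnmBE subnn mpoly.mnm0E.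
Qed.

Lemma gradD M (p q : mpoly.mpoly M K) v : grad (p + q) v = grad p v + grad q v.
Proof. by apply/rowP => k; rewrite !mxE mpoly.mderivD /peval mpoly.mevalD. Qed.

Lemma gradB M (p q : mpoly.mpoly M K) v : grad (p - q) v = grad p v - grad q v.
Proof. by apply/rowP => k; rewrite !mxE mpoly.mderivB /peval mpoly.mevalB. Qed.

Lemma gradM M (p q : mpoly.mpoly M K) v :
  grad (p * q) v = peval q v *: grad p v + peval p v *: grad q v.
Proof.
apply/rowP => k; rewrite !mxE mpoly.mderivM /peval mpoly.mevalD !mpoly.mevalM.
by rewrite [X in X + _]mulrC.
Qed.

(** The image of [D] under the differential of [phi]. *)
Definition velocity (M : nat) (phi : X -> 'rV[K]_M) (D : tvec X) : 'cV[K]_M :=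
  \col_k D (fun y => phi y 0 k).

Context {U : set X} {M : nat} {phi : X -> 'rV[K]_M} (c : chart U phi).

Lemma regular_chart_poly P : regularOn X U (fun x => peval P (phi x)).
Proof.
apply: regular_peval => //; first exact: chart_open c.
by move=> i; exact: chart_coord.
Qed.

Lemma tangent_poly x D P : U x -> tangent x D ->
  D (fun y => peval P (phi y)) = (grad P (phi x) *m velocity phi D) 0 0.
Proof.
move=> Ux tD; have oU := chart_open c.
elim/mpoly_ring_ind: P => [a|i|p q IHp IHq|p q IHp IHq].
- rewrite gradC mul0mx mxE -[RHS](tangent_cst a tD); congr (D _).
  by apply/funext => y; rewrite /peval mpoly.mevalC.
- rewrite gradX -rowE !mxE; congr (D _).
  by apply/funext => y; rewrite /peval mpoly.mevalXU.
- rewrite gradD mulmxDl mxE -IHp -IHq.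
  rewrite -(tangentD tD oU Ux (regular_chart_poly p) (regular_chart_poly q)).
  by congr (D _); apply/funext => y; rewrite /peval mpoly.mevalD.
- rewrite gradM mulmxDl -!scalemxAl mxE [X in X + _]mxE [X in _ + X]mxE.
  rewrite -IHp -IHq addrC.
  rewrite -(tangentM tD oU Ux (regular_chart_poly p) (regular_chart_poly q)).
  by congr (D _); apply/funext => y; rewrite /peval mpoly.mevalM.
Qed.

(** The product rule is applied to F Q = P, which avoids differentiating an inverse. *)
Lemma tangent_frac x D V F P Q : U x -> tangent x D -> open V -> V x ->
  regularOn X V F -> peval Q (phi x) != 0 ->
  (forall z, U z -> V z -> peval Q (phi z) != 0 ->
     F z = peval P (phi z) / peval Q (phi z)) ->
  D F = (frac_grad P Q (phi x) *m velocity phi D) 0 0.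
Proof.
move=> Ux tD oV Vx rF Qx FE; have oU := chart_open c.
have [oD _] := chart_frac c P Q; have rp := regular_chart_poly.
have oW : open (U `&` V) by exact: openI.
have rFW : regularOn X (U `&` V) F by apply: regular_restrict rF => // y [].
have rpW R : regularOn X (U `&` V) (fun y => peval R (phi y)).
  by apply: (regular_restrict oU) => // y [].
have E : D (fun y => F y * peval Q (phi y)) = D (fun y => peval P (phi y)).
  apply: (eq_tangent tD oW oD) => //.
  - exact: regularM.
  - by apply: (regular_restrict oU) => // y [].
  by move=> y [Uy Vy] [_ Qy]; rewrite FE// divfK.
move: E; rewrite (tangentM tD oW)// !(tangent_poly _ Ux tD).
rewrite (FE x Ux Vx Qx) /frac_grad -scalemxAl mulmxBl -scalemxAl.
move: (grad P _ *m _) (grad Q _ *m _) => a b; rewrite !mxE => <-.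
by rewrite addrC addKr mulKf.
Qed.

End TangentVectors.

(** * The tangent space as the common kernel of the differentials of the equations *)

Section TangentSpace.
Context {K : fieldType} {X : funspace K} (ringX : ringed X).
Context {U : set X} {M : nat} {phi : X -> 'rV[K]_M} (c : chart U phi).

Lemma frac_grad_mul (P Q : mpoly.mpoly M K) (v : 'rV[K]_M) (u : 'cV[K]_M) :
  (frac_grad P Q v *m u) 0 0 = ((grad P v *m u) 0 0
     - peval P v / peval Q v * (grad Q v *m u) 0 0) / peval Q v.
Proof.
rewrite /frac_grad -scalemxAl mulmxBl -scalemxAl.
by move: (grad P _ *m _) (grad Q _ *m _) => a b; rewrite !mxE mulrC.
Qed.

Definition frac_repr (x : X) (F : X -> K) P Q :=
  peval Q (phi x) != 0 /\ forall z, U z -> peval Q (phi z) != 0 ->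
     F z = peval P (phi z) / peval Q (phi z).

Lemma frac_reprE V F x : open V -> regularOn X V F -> U x -> V x ->
  exists P Q, frac_repr x F P Q.
Proof.
move=> oV rF Ux Vx; have [P [Q [Qx FE]]] := chart_regular c oV rF Ux Vx.
exists P, Q; split=> [|z Uz Qz]; [exact: Qx | exact: (FE z Uz Qz).2].
Qed.

(** Membership of [u] in the Zariski tangent space of phi(U) at [phi x]. *)
Definition kills_ideal (x : X) (u : 'cV[K]_M) :=
  forall P, (forall z, U z -> peval P (phi z) = 0) ->
    (grad P (phi x) *m u) 0 0 = 0.

(** Differentials of fractions are well defined on germs. The cross difference P Q' - P' Q need not
    vanish on all of [U], but it does after multiplication by Q, Q' and a polynomial R that is zero
    on [U] outside [V]. At [x] these factors are non-zero and the cross difference is zero, so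
    differentiating the product isolates the differential of the cross difference. *)
Lemma frac_grad_germ x u F F' V P Q P' Q' : kills_ideal x u -> U x ->
  open V -> V x -> (forall z, V z -> F z = F' z) ->
  frac_repr x F P Q -> frac_repr x F' P' Q' ->
  (frac_grad P Q (phi x) *m u) 0 0 = (frac_grad P' Q' (phi x) *m u) 0 0.
Proof.
move=> ku Ux oV Vx FF' [Qx FE] [Q'x F'E]; rewrite 2!frac_grad_mul.
(* Only the denominator matters: the zero function on [V] serves to find a polynomial, non-zero at
   [x], whose non-vanishing locus in [U] lies in [V]. *)
have [P0 [R [Rx RV]]] := chart_regular c oV (regular_cst ringX 0 oV) Ux Vx.
have PQE : peval P (phi x) / peval Q (phi x) = peval P' (phi x) / peval Q' (phi
  x).
  by rewrite -FE// -F'E// FF'.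
have /ku : forall z, U z ->
    peval (Q * Q' * R * (P * Q' - P' * Q)) (phi z) = 0.
  move=> z Uz; rewrite /peval !mpoly.mevalM mpoly.mevalB !mpoly.mevalM.
  have [->|Qz] := eqVneq (mpoly.meval (fun i => phi z 0 i) Q) 0;
    first by rewrite !mul0r.
  have [->|Q'z] := eqVneq (mpoly.meval (fun i => phi z 0 i) Q') 0.
    by rewrite mulr0 !mul0r.
  have [->|Rz] := eqVneq (mpoly.meval (fun i => phi z 0 i) R) 0.
    by rewrite mulr0 !mul0r.
  have [Vz _] := RV z Uz Rz.
  have := FF' z Vz; rewrite (FE z Uz Qz) (F'E z Uz Q'z) => /eqP.
  by rewrite eqr_div// => /eqP; rewrite /peval => ->; rewrite subrr mulr0.
have PQ'0 : peval (P * Q' - P' * Q) (phi x) = 0.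
  rewrite /peval mpoly.mevalB !mpoly.mevalM; apply/eqP; rewrite subr_eq0.
  by rewrite -eqr_div// PQE.
rewrite gradM PQ'0 scale0r add0r -scalemxAl mxE => /eqP.
rewrite mulf_eq0 /peval !mpoly.mevalM !mulf_eq0 -!/(peval _ _).
rewrite (negPf Qx) (negPf Q'x) (negPf Rx) /= gradB !gradM mulmxBl !mulmxDl.
rewrite -!scalemxAl.
move: (grad P _ *m _) (grad Q _ *m _) (grad P' _ *m _) (grad Q' _ *m _) =>
  a b a' b'.
have PE : peval P (phi x) = peval P' (phi x) / peval Q' (phi x) * peval Q (phi
  x).
  by rewrite -PQE divfK.
rewrite !mxE PQE; move: PE; set t := peval P' (phi x) / _ => ->.
have -> : peval P' (phi x) = t * peval Q' (phi x) by rewrite divfK.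
move: (peval Q _) (peval Q' _) Qx Q'x => q q' q0 q'0.
move: (a 0 0) (b 0 0) (a' 0 0) (b' 0 0) => r s r' s' /eqP E.
apply/eqP; rewrite eqr_div// -subr_eq0 -[X in _ == X]E.
by apply/eqP; ring.
Qed.

Lemma tangent_of_velocity x u : U x -> kills_ideal x u ->
  exists D, tangent x D /\ velocity phi D = u.
Proof.
move=> Ux ku; have oU := chart_open c.
pose slope F a := exists P Q, frac_repr x F P Q /\
  a = (frac_grad P Q (phi x) *m u) 0 0.
(* The default 0 concerns only functions that are not a fraction near [x]; for all others the slope
   is unique. *)
pose D F := xget 0 [set a | slope F a].
have DE F P Q : frac_repr x F P Q -> D F = (frac_grad P Q (phi x) *m u) 0 0.
  move=> FPQ; rewrite /D; case: xgetP => [a -> [P' [Q' [FPQ' ->]]]|no].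
    exact: (@frac_grad_germ x u F F U).
  by exfalso; apply: (no ((frac_grad P Q (phi x) *m u) 0 0)); exists P, Q.
exists D; split.
  move=> V F G oV Vx rF rG.
  have [P [Q FPQ]] := frac_reprE oV rF Ux Vx.
  have [P' [Q' GPQ]] := frac_reprE oV rG Ux Vx.
  have [[Qx FE] [Q'x GE]] := (FPQ, GPQ).
  split.
  - by move=> FG; rewrite (DE _ _ _ FPQ) (DE _ _ _ GPQ);
      exact: (@frac_grad_germ x u F G V).
  - move=> a.
    have h : frac_repr x (fun y => a * F y + G y)
        (mpoly.mpolyC M a * P * Q' + P' * Q) (Q * Q').
      split=> [|z Uz]; rewrite /peval !mpoly.mevalM; first by rewrite mulf_neq0.
      rewrite mulf_eq0 negb_or => /andP[Qz Q'z].
      rewrite mpoly.mevalD !mpoly.mevalM mpoly.mevalC FE// GE//.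
      by rewrite -addf_div// -mulrA [a * (_ / _)]mulrA.
    rewrite (DE _ _ _ h) (DE _ _ _ FPQ) (DE _ _ _ GPQ) !frac_grad_mul.
    rewrite !(gradD, gradM, gradC) scaler0 add0r.
    rewrite !mulmxDl -!scalemxAl.
    rewrite /peval !(mpoly.mevalM, mpoly.mevalD, mpoly.mevalC) -!/(peval _ _).
    move: (grad P _ *m _) (grad Q _ *m _) (grad P' _ *m _) (grad Q' _ *m _) =>
      p q p' q'.
    by rewrite !mxE; field; rewrite Qx Q'x.
  - have h : frac_repr x (fun y => F y * G y) (P * P') (Q * Q').
      split=> [|z Uz]; rewrite /peval !mpoly.mevalM; first by rewrite mulf_neq0.
      rewrite mulf_eq0 negb_or => /andP[Qz Q'z].
      by rewrite FE// GE// mulf_div.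
    rewrite (DE _ _ _ h) (DE _ _ _ FPQ) (DE _ _ _ GPQ) !frac_grad_mul.
    rewrite !gradM !mulmxDl -!scalemxAl FE// GE//.
    rewrite /peval !mpoly.mevalM -!/(peval _ _).
    move: (grad P _ *m _) (grad Q _ *m _) (grad P' _ *m _) (grad Q' _ *m _) =>
      p q p' q'.
    by rewrite !mxE; field; rewrite Qx Q'x.
apply/colP => k; rewrite !mxE.
have h : frac_repr x (fun y => phi y 0 k) (mpoly.mpolyX K (mpoly.mnm1 k)) 1.
  rewrite /frac_repr /peval mpoly.meval1 oner_eq0; split=> // z _ _.
  by rewrite mpoly.mevalXU mpoly.meval1 divr1.
rewrite (DE _ _ _ h) frac_grad_mul gradX -mpoly.mpolyC1 gradC mul0mx.
by rewrite -rowE !mxE mulr0 subr0 /peval mpoly.mevalC divr1.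
Qed.

End TangentSpace.

(** A tuple of maximal rank spans. This replaces finite generation of the ideal of [U]: at a single
    point, the differentials of finitely many equations span those of all. *)
Lemma finite_spanning_rows (K : fieldType) (M : nat) (S : 'rV[K]_M -> Prop) :
  exists N (A : 'M[K]_(N, M)), (forall i, S (row i A)) /\
    forall s, S s -> (s <= A)%MS.
Proof.
pose good r := `[< exists N (A : 'M[K]_(N, M)),
  (forall i, S (row i A)) /\ \rank A = r >].
have ex : exists r, good r.
  exists 0%N; apply/asboolP; exists 0%N, 0; split; first by case.
  by rewrite mxrank0.
have ub r : good r -> (r <= M)%N.
  by move/asboolP => [N [A [_ <-]]]; exact: rank_leq_col.
case: (ex_maxnP ex ub) => r /asboolP[N [A [SA rA]]] max_r.
exists N, A; split=> // s Ss; apply/negPn/negP => sA.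
have lt : (A < A + s)%MS.
  by rewrite ltmxE addsmxSl; apply: contraNN sA;
    apply: submx_trans (addsmxSr _ _).
suff /max_r : good (\rank (A + s)%MS) by rewrite -rA leqNgt rank_ltmx.
apply/asboolP; exists (N + 1)%N, (col_mx A s).
split; last by rewrite addsmxE.
move=> i; rewrite -(splitK i); case: (fintype.split i) => k /=.
  by rewrite rowKu.
by rewrite rowKd row_id.
Qed.

(** * Frames of the cotangent bundle near a point *)

Section LocalFrame.
Context {K : fieldType} {X : funspace K} (ringX : ringed X).

Definition regular_mx (a b : nat) (W : set X) (f : X -> 'M[K]_(a, b)) :=
  forall i j, regularOn X W (fun x => f x i j).

Lemma regular_mulmx a b e W (f : X -> 'M[K]_(a, b)) (g : X -> 'M[K]_(b, e)) :
  open W -> regular_mx W f -> regular_mx W g ->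
  regular_mx W (fun x => f x *m g x).
Proof.
move=> oW rf rg i j; apply: (@eq_regular _ X W _ (fun x =>
  \sum_k f x i k * g x k j)) => //.
  by move=> x _; rewrite mxE.
by apply: regular_sum => // k; exact: regularM.
Qed.

Lemma regular_invmx a W (f : X -> 'M[K]_a) : open W -> regular_mx W f ->
  (forall x, W x -> \det (f x) != 0) -> regular_mx W (fun x => invmx (f x)).
Proof.
move=> oW rf f0 i j.
apply: (@eq_regular _ X W _ (fun x => (\det (f x))^-1 *
    ((-1) ^+ (j + i) * \det (row' j (col' i (f x)))))) => //.
  by move=> x Wx; rewrite /invmx unitmxE unitfE f0// !mxE.
have rdet b (h : X -> 'M[K]_b) : regular_mx W h -> regularOn X W (fun x =>
  \det (h x)).
  exact: regular_det.
apply: regularM => //; first by apply: regularV => //; exact: rdet.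
apply: regularM => //; first exact: regular_cst.
apply: rdet => k l; apply: (eq_regular oW _ (rf (lift j k) (lift i l))) => x _.
by rewrite !mxE.
Qed.

Lemma regular_mx_restrict a b (V W : set X) (f : X -> 'M[K]_(a, b)) :
  open V -> open W -> W `<=` V -> regular_mx V f -> regular_mx W f.
Proof. by move=> oV oW WV rf i j; exact: (regular_restrict oV). Qed.

Context {U : set X} {M : nat} {phi : X -> 'rV[K]_M} (c : chart U phi).

Lemma regular_grad P : regular_mx U (fun x => grad P (phi x)).
Proof.
move=> i k.
apply: (eq_regular (chart_open c) _ (regular_chart_poly ringX c (mpoly.mderiv k
  P))).
by move=> x _; rewrite mxE.
Qed.

Lemma regular_frac_grad P Q :
  regular_mx (U `&` [set x | peval Q (phi x) != 0])
    (fun x => frac_grad P Q (phi x)).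
Proof.
move=> i k; have [oD rD] := chart_frac c P Q; have [_ rD1] := chart_frac c 1 Q.
have rg R : regularOn X (U `&` [set x | peval Q (phi x) != 0])
    (fun x => grad R (phi x) i k).
  by apply: (regular_restrict (chart_open c) _ _ (regular_grad R i k)) => //
    x [].
apply: (@eq_regular _ X _ _ (fun x => (peval 1 (phi x) / peval Q (phi x)) *
   (grad P (phi x) i k + (-1) * (peval P (phi x) / peval Q (phi x) * grad Q
     (phi x) i k)))) => //.
  by move=> x _; rewrite /peval mpoly.meval1 div1r mulN1r !mxE.
apply: (regularM ringX) => //; apply: (regularD ringX) => //.
apply: (regularM ringX) => //; first exact: (regular_cst ringX).
exact: (regularM ringX).
Qed.

(** On a space of dimension [d], functions with non-zero Jacobian on one tuple [D0] have independent
    differentials, hence separate all tangent vectors. *)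
Lemma tangent_separated x d (g : 'I_d -> X -> K) V (D0 : 'I_d -> tvec X) D :
  U x -> tangent_dim x d -> open V -> V x -> (forall i, regularOn X V (g i)) ->
  (forall i, tangent x (D0 i)) -> \det (\matrix_(i, j) D0 j (g i)) != 0 ->
  tangent x D -> (forall i, D (g i) = 0) -> velocity phi D = 0.
Proof.
move=> Ux [E [tE EP]] oV Vx rg tD0 det0 tD Dg.
have /choice[C CE] : forall j, exists e : 'rV[K]_d, forall V f, open V -> V x ->
    regularOn X V f -> D0 j f = \sum_l e 0 l * E l f.
  by move=> j; have [e [eE _]] := EP _ (tD0 j); exists e.
have [e [eE _]] := EP D tD.
pose Eg := \matrix_(l, i) E l (g i).
(* Expanding [D0] in the basis [E] factors the Jacobian through [Eg], which is therefore
   invertible. *)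
have CEg : (\matrix_j C j) *m Eg = (\matrix_(i, j) D0 j (g i))^T.
  apply/matrixP => j i; rewrite !mxE (CE j V _ oV Vx (rg i)).
  by apply: eq_bigr => l _; rewrite !mxE.
have uEg : Eg \in unitmx.
  move: det0; rewrite -det_tr -CEg det_mulmx mulf_eq0 negb_or => /andP[_ Eg0].
  by rewrite unitmxE unitfE.
have e0 : e = 0.
  rewrite -(mulmxK uEg e) (_ : e *m Eg = 0) ?mul0mx//.
  apply/rowP => i; rewrite !mxE -[RHS](Dg i) (eE V _ oV Vx (rg i)).
  by apply: eq_bigr => l _; rewrite !mxE.
apply/colP => k; rewrite !mxE (eE U _ (chart_open c) Ux (chart_coord k c)) e0.
by rewrite big1// => l _; rewrite mxE mul0r.
Qed.

(** The differentials at [x] of the equations of [U] and of the [g i] span the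
    cotangent space of affine space;
      a left inverse of the Jacobian matrix at [x]
    times the Jacobian matrix is invertible near [x], where it expresses all
    differentials on [X] through those of the [g i]. *)
Lemma local_frame x d (g : 'I_d -> X -> K) V (D0 : 'I_d -> tvec X) :
  U x -> tangent_dim x d -> open V -> V x -> (forall i, regularOn X V (g i)) ->
  (forall i, tangent x (D0 i)) -> \det (\matrix_(i, j) D0 j (g i)) != 0 ->
  forall V' F, open V' -> V' x -> regularOn X V' F ->
  exists W (a : 'I_d -> X -> K), [/\ open W, W x, forall i,
    regularOn X W (a i) &
    forall y D, W y -> tangent y D -> D F = \sum_i a i y * D (g i)].
Proof.
move=> Ux dimx oV Vx rg tD0 det0 V' F oV' V'x rF.
have oU := chart_open c.
have [p [q [qx FE]]] := chart_regular c oV' rF Ux V'x.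
have /choice[PQ PQE] : forall i, exists PQ : mpoly.mpoly M K * mpoly.mpoly M K,
    peval PQ.2 (phi x) != 0 /\ forall z, U z -> peval PQ.2 (phi z) != 0 ->
      V z /\ g i z = peval PQ.1 (phi z) / peval PQ.2 (phi z).
  move=> i; have [P [Q h]] := chart_regular c oV (rg i) Ux Vx.
  by exists (P, Q).
have [N [A [SA spanA]]] := finite_spanning_rows (fun s => exists P,
  (forall z, U z -> peval P (phi z) = 0) /\ s = grad P (phi x)).
have /choice[I IE] := SA.
pose G (v : 'rV[K]_M) := \matrix_i frac_grad (PQ i).1 (PQ i).2 v.
pose J (v : 'rV[K]_M) := col_mx (\matrix_i grad (I i) v) (G v).
have velG y D : U y -> tangent y D -> (forall i, peval (PQ i).2 (phi y) != 0) ->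
    G (phi y) *m velocity phi D = \col_i D (g i).
  move=> Uy tD Qy; apply/colP => i.
  have Vy : V y by have [] := (PQE i).2 y Uy (Qy i).
  rewrite [RHS]mxE (tangent_frac (P :=
    (PQ i).1) ringX c Uy tD oV Vy (rg i) (Qy i)); last first.
    by move=> z Uz _ Qz; exact: ((PQE i).2 z Uz Qz).2.
  rewrite -(rowK (fun i => frac_grad (PQ i).1 (PQ i).2 (phi y)) i) -row_mul.
  by rewrite [RHS]mxE.
have velI y D : U y -> tangent y D ->
    (\matrix_i grad (I i) (phi y)) *m velocity phi D = 0.
  move=> Uy tD; apply/colP => i; rewrite [RHS]mxE.
  transitivity (D (fun y => peval (I i) (phi y))).
    rewrite (tangent_poly ringX c _ Uy tD).
    by rewrite -[in RHS](rowK (fun i =>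
      grad (I i) (phi y)) i) -row_mul [RHS]mxE.
  rewrite -(tangent_cst ringX 0 tD).
  apply: (eq_tangent tD oU openT Uy Logic.I) => //.
  - exact: regular_chart_poly.
  - by apply: (regular_cst ringX); exact: openT.
  - by move=> z Uz _; have [+ _] := IE i; apply.
(* A vector in the kernel of [J] satisfies the equations of the tangent space, so it is the velocity
   of a derivation; this derivation kills all [g i], so the vector is zero. *)
have full : row_full (J (phi x)).
  rewrite -cokermx_eq0; apply/eqP.
  suff ker0 (u : 'cV[K]_M) : J (phi x) *m u = 0 -> u = 0.
    apply/matrixP => i j;
      suff /ker0/colP/(_ i) : J (phi x) *m col j (cokermx (J (phi x))) = 0.
      by rewrite [LHS]mxE => ->; rewrite !mxE.
    by rewrite colE mulmxA mulmx_coker mul0mx.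
  rewrite /J mul_col_mx => /eqP; rewrite col_mx_eq0 => /andP[/eqP Au /eqP Gu].
  have ku : @kills_ideal _ _ U _ phi x u.
    move=> P PI; have /submxP[e ->] : (grad P (phi x) <= A)%MS.
      by apply: spanA; exists P.
    rewrite -mulmxA (_ : A = \matrix_i grad (I i) (phi x)).
      by rewrite Au mulmx0 mxE.
    by apply/row_matrixP => i; rewrite rowK; have [_ ->] := IE i.
  have [D [tD Du]] := tangent_of_velocity ringX c Ux ku.
  rewrite -Du; apply: (tangent_separated Ux dimx oV Vx rg tD0 det0 tD) => i.
  have /colP/(_ i) := velG x D Ux tD (fun i => (PQE i).1).
  by rewrite Du Gu !mxE.
have /row_fullP[B BJ] := full.
pose Q := q * \prod_i (PQ i).2.
have QE z : peval Q z = peval q z * \prod_i peval (PQ i).2 z.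
  by rewrite /peval mpoly.mevalM rmorph_prod.
have QPz z : peval Q z != 0 -> forall i, peval (PQ i).2 z != 0.
  rewrite QE mulf_eq0 negb_or => /andP[_ /prodf_neq0 h] i; exact: h.
have [oW0 _] := chart_frac c 1 Q; set W0 := _ `&` _ in oW0.
have W0x : W0 x.
  split=> //=; rewrite QE mulf_neq0//; apply/prodf_neq0 => i _;
    exact: (PQE i).1.
have rJ : regular_mx W0 (fun y => B *m J (phi y)).
  apply: (@regular_mulmx _ _ _ _ (fun=> B)) => //.
    by move=> i j; exact: (regular_cst ringX).
  move=> i j; rewrite -(splitK i); case: (fintype.split i) => k.
    apply: (eq_regular oW0 _ (regular_restrict oU oW0 _ (regular_grad (I k) 0
      j))).
      by move=> y _; rewrite col_mxEu mxE.
    by move=> y [].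
  have [oDk _] := chart_frac c 1 (PQ k).2.
  apply: (eq_regular oW0 _ (regular_restrict oDk oW0 _ (regular_frac_grad (PQ
    k).1 (PQ k).2 0 j))).
    by move=> y _; rewrite col_mxEd mxE.
  by move=> y [Uy Qy]; split=> //; exact: QPz.
have rdet := regular_det ringX oW0 rJ.
pose W := W0 `&` [set y | \det (B *m J (phi y)) != 0].
have oW : open W := open_regular_neq0 ringX oW0 rdet.
have WW0 : W `<=` W0 by move=> y [].
have [oDq _] := chart_frac c 1 q.
(* [J] maps a velocity to zeros followed by the values D (g i), so only the last [d] entries of the
   coefficient row contribute. *)
exists W, (fun i y =>
  (frac_grad p q (phi y) *m invmx (B *m J (phi y)) *m B) 0 (rshift N i)).
split=> //.
- by split=> //=; rewrite BJ det1 oner_eq0.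
- move=> i; apply: regular_mulmx => //; last by move=> k l;
    exact: (regular_cst ringX).
  apply: regular_mulmx => //.
    apply: regular_mx_restrict (regular_frac_grad p q) => // y [[Uy Qy] _];
      split=> //=.
    by move: Qy; rewrite /= QE mulf_eq0 negb_or => /andP[].
  apply: regular_invmx => //; first exact: regular_mx_restrict rJ.
  by move=> y [].
- move=> y D [[Uy Qy] dety] tD.
  have qy : peval q (phi y) != 0.
    by move: Qy; rewrite /= QE mulf_eq0 negb_or => /andP[].
  have V'y : V' y by have [] := FE y Uy qy.
  rewrite (tangent_frac (P := p) ringX c Uy tD oV' V'y rF qy); last first.
    by move=> z Uz _ qz; exact: (FE z Uz qz).2.
  have uBJ : B *m J (phi y) \in unitmx by rewrite unitmxE unitfE.
  rewrite -[velocity phi D](mulKmx uBJ) -(mulmxA B) /J mul_col_mx velI//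
    velG//; last exact: QPz.
  rewrite !mulmxA [LHS]mxE big_split_ord /= big1 ?add0r.
    by apply: eq_bigr => i _; rewrite col_mxEd !mxE.
  by move=> i _; rewrite col_mxEu [X in _ * X]mxE mulr0.
Qed.

End LocalFrame.

(** * Pluricanonical forms *)

Section PluriformRatio.
Context {K : fieldType} {X : funspace K} (ringX : ringed X).

Lemma regularX U f e : open U -> regularOn X U f ->
  regularOn X U (fun x => f x ^+ e).
Proof.
move=> oU rf; elim: e => [|e IH].
  by apply: (@eq_regular _ X U _ (fun=> 1)) (regular_cst ringX _ oU) => // x _;
    rewrite expr0.
by apply: (@eq_regular _ X U _ _ _ _ (regularM ringX oU rf IH)) => // x _;
  rewrite exprS.
Qed.

Context {d : nat} (dimX : forall x : X, tangent_dim x d).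
Context (affX : forall x : X, exists U : set X, [/\ open U, U x & affine U]).

Definition nonvanishing (w : form X d) (x : X) : Prop :=
  exists D : 'I_d -> tvec X, (forall i, tangent x (D i)) /\ w x D != 0.

Lemma finite_open_bigcap (I : finType) (T : topologicalType) (W : I -> set T) :
  (forall i, open (W i)) -> open [set x | forall i, W i x].
Proof.
move=> oW; suff oS (s : seq I) : open [set x | forall i, i \in s -> W i x].
  rewrite (_ : [set x | _] = [set x | forall i, i \in enum I -> W i x])//.
  by apply/seteqP; split=> x h i; [move=> _; exact: h|apply: h;
    rewrite mem_enum].
elim: s => [|i s IH].
  by rewrite (_ : [set x | _] = setT); [exact: openT|apply/seteqP; split=> x].
rewrite (_ : [set x | _] = W i `&` [set x | forall i, i \in s -> W i x]).
  exact: openI.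
apply/seteqP; split=> x.
  by move=> h; split=> [|k ks]; apply: h; rewrite inE ?eqxx// ks orbT.
by move=> [Wi h] k; rewrite inE => /orP[/eqP->//|]; exact: h.
Qed.

(** Where [w] does not vanish, its functions [g] have independent differentials, so those of the
    other form are expressed through them. The m-th power of the determinant of this base change
    gives the quotient. *)
Lemma pluriform_ratio m (O : set X) (w w' : form X d) x : (0 < m)%N ->
  open O -> O x -> pluriform m O w -> pluriform m O w' -> nonvanishing w x ->
  exists V k, [/\ open V, V x, regularOn X V k &
    forall y, V y -> nonvanishing w y /\
      forall D, (forall i, tangent y (D i)) -> w' y D = k y * w y D].
Proof.
move=> m_gt0 oO Ox pw pw' [D0 [tD0 wD0]].
have [V [h [g [oV Vx rh rg wE]]]] := pw x Ox.
have [V' [h' [g' [oV' V'x rh' rg' w'E]]]] := pw' x Ox.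
have [U [oU Ux aU]] := affX x; have [M [phi c]] := affine_chart oU aU.
move: (wD0); rewrite wE// mulf_eq0 negb_or expf_eq0 m_gt0 /= => /andP[hx det0].
have frame := local_frame ringX c Ux (dimX x) oV Vx rg tD0 det0.
have /choice[Wa WaE] : forall i, exists Wa : set X * ('I_d -> X -> K),
    [/\ open Wa.1, Wa.1 x, forall j, regularOn X Wa.1 (Wa.2 j) &
     forall y D, Wa.1 y -> tangent y D -> D (g' i) = \sum_j Wa.2 j y * D (g j)].
  by move=> i; have [W [a H]] := frame V' (g' i) oV' V'x (rg' i); exists (W, a).
(* The chart coordinates are expanded in the same frame in order to show that [w] stays
   non-vanishing near [x]. *)
have /choice[Wb WbE] : forall k, exists Wb : set X * ('I_d -> X -> K),
    [/\ open Wb.1, Wb.1 x, forall j, regularOn X Wb.1 (Wb.2 j) &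
     forall y D, Wb.1 y -> tangent y D ->
       D (fun z => phi z 0 k) = \sum_j Wb.2 j y * D (g j)].
  move=> k; have [W [b H]] := frame U _ oU Ux (chart_coord k c).
  by exists (W, b).
pose W := O `&` (V `&` [set y | h y != 0]) `&` (V' `&` U) `&`
  ([set y | forall i, (Wa i).1 y] `&` [set y | forall k, (Wb k).1 y]).
have oW : open W.
  apply: openI.
    by do 2?apply: openI => //; exact: (open_regular_neq0 ringX).
  apply: openI; apply: finite_open_bigcap => i; [by have [] :=
    WaE i|by have [] := WbE i].
have Wx : W x.
  by split; split=> //= i; [have [] := WaE i|have [] := WbE i].
pose a y := \matrix_(i, j) (Wa i).2 j y.
exists W, (fun y => h' y * \det (a y) ^+ m * (h y)^-1); split=> //.
- have rW V0 f : open V0 -> W `<=` V0 -> regularOn X V0 f -> regularOn X W f.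
    by move=> oV0 WV0 rf; exact: (regular_restrict oV0).
  apply: (regularM ringX) => //; last first.
    apply: (regularV ringX) => //; first by apply: rW rh => // y [[[_ []]]].
    by move=> y [[[_ []]]].
  apply: (regularM ringX) => //; first by apply: rW rh' => // y [[_ []]].
  apply: regularX => //; apply: (regular_det ringX) => // i j.
  have [oWi _ rWi _] := WaE i.
  apply: (eq_regular oW _ (rW _ _ oWi _ (rWi j))) => y; first by rewrite mxE.
  by move=> [_ [/= ]].
move=> y [[[Oy [Vy hy]] [V'y Uy]] [Way Wby]]; split; last first.
  move=> D tD; rewrite wE// w'E//.
  have -> : \matrix_(i, j) D j (g' i) = a y *m \matrix_(i, j) D j (g i).
    apply/matrixP => i j; rewrite !mxE; have [_ _ _ aE] := WaE i;
      rewrite (aE y)//.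
    by apply: eq_bigr => l _; rewrite !mxE.
  by rewrite det_mulmx exprMn -!mulrA; rewrite mulKf.
have [E [tE EP]] := dimX y.
(* A linear relation between the values of the basis [E] on the frame extends to the chart
   coordinates, then to all regular functions; uniqueness of the coordinates of the zero vector
   makes it trivial. *)
exists E; split=> //; rewrite wE// mulf_neq0// expf_neq0//.
rewrite -det_tr; apply/negP => /det0P[v v0 vE].
have [e [_ e_uniq]] := EP _ (@tangent_cst0 _ X y).
case/negP: v0; apply/eqP; rewrite -(e_uniq v) ?(e_uniq 0)//.
  by move=> V0 f _ _ _; rewrite big1// => i _; rewrite mxE mul0r.
move=> V0 f oV0 V0y rf.
have [P [Q [Qy fE]]] := chart_regular c oV0 rf Uy V0y.
transitivity ((frac_grad P Q (phi y) *m \sum_i v 0 i *: velocity phi (E i)) 0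
  0).
  rewrite (_ : \sum_i _ = 0) ?mulmx0 ?mxE//.
  apply/colP => k; rewrite summxE [RHS]mxE.
  transitivity (\sum_l (Wb k).2 l y * (v *m (\matrix_(i, j) E j (g i))^T) 0 l).
    rewrite [RHS](eq_bigr (fun l => \sum_i v 0 i * ((Wb k).2 l y * E i (g l)))).
      rewrite exchange_big; apply: eq_bigr => i _; rewrite !mxE -mulr_sumr.
      by have [_ _ _ bE] := WbE k; rewrite (bE y).
    move=> l _; rewrite mxE mulr_sumr; apply: eq_bigr => i _; rewrite !mxE.
    by rewrite mulrCA.
  by rewrite vE big1// => l _; rewrite mxE mulr0.
rewrite mulmx_sumr summxE; apply: eq_bigr => i _.
rewrite -scalemxAr [LHS]mxE (tangent_frac (P :=
  P) ringX c Uy (tE i) oV0 V0y rf Qy)//.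
by move=> z Uz _ Qz; exact: (fE z Uz Qz).2.
Qed.

(** The functions are the combinations of chart coordinates dual to a basis of the tangent space at
    [x]; [B] exists because the velocities of that basis are independent. *)
Lemma pluriform_frame (x : X) : exists V (g : 'I_d -> X -> K),
  [/\ open V, V x, forall i, regularOn X V (g i) &
   forall m, nonvanishing (fun y D => \det (\matrix_(i, j) D j (g i)) ^+ m) x].
Proof.
have [U [oU Ux aU]] := affX x; have [M [phi c]] := affine_chart oU aU.
have [E [tE EP]] := dimX x.
pose T := \matrix_(j < d) (velocity phi (E j))^T.
have /row_freeP[B TB] : row_free T.
  rewrite -kermx_eq0; apply/eqP/row_matrixP => i; rewrite row0.
  have [e [_ e_uniq]] := EP _ (@tangent_cst0 _ X x).
  rewrite -(e_uniq (row i (kermx T))) ?(e_uniq 0)//.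
    by move=> V0 f _ _ _; rewrite big1// => k _; rewrite mxE mul0r.
  move=> V f oV Vx rf; have [P [Q [Qx fE]]] := chart_regular c oV rf Ux Vx.
  set v := row i _; have vT : v *m T = 0 by rewrite -row_mul mulmx_ker row0.
  transitivity ((frac_grad P Q (phi x) *m (v *m T)^T) 0 0).
    by rewrite vT trmx0 mulmx0 mxE.
  rewrite trmx_mul mulmxA [LHS]mxE; apply: eq_bigr => j _.
  rewrite (tangent_frac (P := P) ringX c Ux (tE j) oV Vx rf Qx).
    rewrite [v^T _ _]mxE mulrC; congr (_ * _); rewrite 2!mxE.
    by apply: eq_bigr => k _; rewrite !mxE.
  by move=> z Uz _ Qz; exact: (fE z Uz Qz).2.
exists U, (fun i y => \sum_k B k i * phi y 0 k); split=> //.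
  move=> i; apply: regular_sum => // k; apply: (regularM ringX) => //.
    exact: (regular_cst ringX).
  exact: (chart_coord k c).
move=> m; exists E; split=> //; rewrite expf_neq0//.
rewrite (_ : \matrix_(i, j) _ = 1%:M) ?det1 ?oner_eq0//.
rewrite -[RHS]trmx1 -TB; apply/matrixP => i j; rewrite !mxE.
have rsum (s : seq 'I_M) : E j (fun y => \sum_(k <- s) B k i * phi y 0 k) =
    \sum_(k <- s) B k i * E j (fun y => phi y 0 k).
  elim: s => [|k s IH].
    rewrite big_nil -[RHS](tangent_cst ringX 0 (tE j)); congr (E j _).
    by apply/funext => y; rewrite big_nil.
  rewrite big_cons -IH -(tangent_linear _ (tE j) oU Ux).
  - by congr (E j _); apply/funext => y; rewrite big_cons.
  - exact: (chart_coord k c).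
  - apply: regular_sum => // l; apply: (regularM ringX) => //.
      exact: (regular_cst ringX).
    exact: (chart_coord l c).
by rewrite rsum; apply: eq_bigr => k _; rewrite !mxE mulrC.
Qed.

(** The presentations of [w] and [w'] use different functions [g], so the sum is not visibly of the
    required shape. Both forms are first rewritten as multiples of one local generator [eta]. *)
Lemma pluriform_linear m (O : set X) (w w' : form X d) a : (0 < m)%N ->
  open O -> pluriform m O w -> pluriform m O w' ->
  pluriform m O (fun x D => a * w x D + w' x D).
Proof.
move=> m_gt0 oO pw pw' x Ox; have [V [g [oV Vx rg nvg]]] := pluriform_frame x.
pose eta : form X d := fun y D => \det (\matrix_(i, j) D j (g i)) ^+ m.
have restr (u : form X d) : pluriform m O u -> pluriform m (O `&` V) u.
  move=> pu y [Oy Vy]; have [V0 [h [g0 [oV0 V0y rh rg0 uE]]]] := pu y Oy.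
  by exists V0, h, g0; split=> // z D [[Oz _] V0z] tD; exact: uE.
have oOV : open (O `&` V) by exact: openI.
have peta : pluriform m (O `&` V) eta.
  move=> y [Oy Vy]; exists V, (fun=> 1), g; split=> //.
    exact: (regular_cst ringX).
  by move=> z D _ _; rewrite mul1r.
have OVx : (O `&` V) x by [].
have [V1 [k1 [oV1 V1x rk1 wE]]] :=
  pluriform_ratio m_gt0 oOV OVx peta (restr _ pw) (nvg m).
have [V2 [k2 [oV2 V2x rk2 w'E]]] :=
  pluriform_ratio m_gt0 oOV OVx peta (restr _ pw') (nvg m).
have oW : open (V1 `&` V2 `&` V) by do 2?apply: openI.
exists (V1 `&` V2 `&` V), (fun y => a * k1 y + k2 y), g; split=> //.
- apply: (regularD ringX) => //; last first.
    by apply: (regular_restrict oV2 oW _ rk2) => y [[]].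
  apply: (regularM ringX) => //; first exact: (regular_cst ringX).
  by apply: (regular_restrict oV1 oW _ rk1) => y [[]].
- by move=> i; apply: (regular_restrict oV oW _ (rg i)) => y [].
- move=> y D [_ [[V1y V2y] _]] tD.
  by rewrite (wE y V1y).2// (w'E y V2y).2// mulrDl mulrA.
Qed.

Lemma pluriform0 m (O : set X) : pluriform m O ((fun _ _ => 0) : form X d).
Proof.
move=> x _; exists setT, (fun=> 0), (fun _ _ => 0); split=> //.
- exact: openT.
- exact/(regular_cst ringX)/openT.
- by move=> i; exact/(regular_cst ringX)/openT.
- by move=> y D _ _; rewrite mul0r.
Qed.
End PluriformRatio.

(** * Multiprojective spaces *)

Section ChartsOfMultiprojectiveSpace.
Context {K : fieldType}.
Implicit Types X Y : funspace K.

Lemma morphism_to_coord X Y (N : nat) (coord : Y -> 'rV[K]_N -> Prop)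
  (S O : set X) (f : X -> Y) (a : X -> 'rV[K]_N) : ringed X ->
  (forall U : set Y, open U -> coord_open coord U) ->
  (forall (U : set Y) h, regularOn Y U h -> coord_regular coord U (fun y _ =>
    h y)) ->
  open O -> S `<=` O -> (forall i, regularOn X O (fun x => a x 0 i)) ->
  (forall x, S x -> coord (f x) (a x)) -> morphism_on S f.
Proof.
move=> ringX openY regY oO SO ra fa.
have oD P : open (O `&` [set x | peval P (a x) != 0]).
  exact: (open_regular_neq0 ringX oO (regular_peval ringX P oO ra)).
split.
  apply: within_continuousI => W x oW Sx Wfx.
  have [o [ox oE]] := openY W oW _ _ Wfx (fa x Sx).
  exists (O `&` [set x | peval o (a x) != 0]); split=> //.
    by split=> //; exact: SO.
  by move=> y Sy [_ oy]; exact: oE (fa y Sy) oy.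
move=> W h oW rh x [Sx Wfx].
have [p [q [qx hE]]] := regY W h rh _ _ Wfx (fa x Sx).
exists (O `&` [set x | peval q (a x) != 0]).
exists (fun x => peval p (a x) * (peval q (a x))^-1); split=> //.
- by split=> //; exact: SO.
- have raD i : regularOn X (O `&` [set x | peval q (a x) != 0]) (fun x =>
    a x 0 i).
    by apply: (regular_restrict oO _ _ (ra i)) => // y [].
  apply: (regularM ringX) => //; first exact: regular_peval.
  by apply: (regularV ringX) => // [|y []//]; exact: regular_peval.
- move=> y [Sy Wfy] [Oy qy].
  by rewrite /= (hE (f y) (a y))//; exact: fa.
Qed.

Lemma morphism_to_multiproj X (n e : nat) (S O : set X) (f : X ->
  multiproj K n e)
  (A : X -> 'M[K]_(n, e.+1)) : ringed X -> open O -> S `<=` O ->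
  (forall i j, regularOn X O (fun x => A x i j)) ->
  (forall x, S x -> homog_coord (f x) (A x)) -> morphism_on S f.
Proof.
move=> ringX oO SO rA fA.
apply: (morphism_to_coord (Y := multiproj K n e) (coord :=
  @multiproj_coord K n e) (O := O) (a := fun x => mxvec (A x))) => //.
  move=> i; case: (mxvec_indexP i) => j k.
  by apply: (eq_regular oO _ (rA j k)) => x _; rewrite mxvecE.
by move=> x Sx; rewrite /multiproj_coord mxvecK; exact: fA.
Qed.

Lemma morphism_to_affine X (N : nat) (S O : set X) (f : X -> affine_space K N) :
  ringed X -> open O -> S `<=` O ->
  (forall i, regularOn X O (fun x => (f x : 'rV[K]_N) 0 i)) -> morphism_on S f.
Proof.
move=> ringX oO SO rf.
by apply: (@morphism_to_coord X (affine_space K N) N (@affine_coord K N) S O f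
  f).
Qed.

(** The affine chart of a multiprojective space given by the non-vanishing of
    the linear form [c] in each group of homogeneous coordinates. *)
Section LinearChart.
Context {n e : nat} (c : 'cV[K]_e.+1).
Local Notation Y := (multiproj K n e).
Implicit Types (x y : Y) (A : 'M[K]_(n, e.+1)).

Definition normalized x A := homog_coord x A /\ forall j, (A *m c) j 0 = 1.

Definition normal_coord x : 'M[K]_(n, e.+1) := xget 0 [set A | normalized x A].

Definition lin_chart : set Y :=
  [set x | exists A, homog_coord x A /\ forall j, (A *m c) j 0 != 0].

Lemma scale_lin_form (t : 'I_n -> K) A j :
  ((\matrix_(i, k) (t i * A i k)) *m c) j 0 = t j * (A *m c) j 0.
Proof.
rewrite !mxE mulr_sumr; apply: eq_bigr => k _.
by rewrite mxE mulrA.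
Qed.

Lemma normalize_coord x A : homog_coord x A -> (forall j, (A *m c) j 0 != 0) ->
  normalized x (\matrix_(j, k) (A j k / (A *m c) j 0)).
Proof.
move=> xA A0; have -> : \matrix_(j, k) (A j k / (A *m c) j 0) =
    \matrix_(j, k) (((A *m c) j 0)^-1 * A j k).
  by apply/matrixP => j k; rewrite !mxE mulrC.
split=> [|j]; last by rewrite scale_lin_form mulVf.
by apply: homog_coord_scale => // j; rewrite invr_neq0.
Qed.

Lemma normal_coordE x A : homog_coord x A -> (forall j, (A *m c) j 0 != 0) ->
  normal_coord x = \matrix_(j, k) (A j k / (A *m c) j 0).
Proof.
move=> xA A0; rewrite /normal_coord; case: xgetP => [B _ [xB B1]|no].
  have [t [t0 BE]] := homog_coord_uniq xA xB.
  apply/matrixP => j k; rewrite [RHS]mxE BE mxE.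
  have := B1 j; rewrite BE scale_lin_form => tA.
  by rewrite -[t j](mulfK (A0 j)) tA mul1r mulrC.
by exfalso; apply: (no _); exact: normalize_coord xA A0.
Qed.

Lemma normal_coordP x : lin_chart x -> normalized x (normal_coord x).
Proof.
by move=> [A [xA A0]]; rewrite (normal_coordE xA A0); exact: normalize_coord.
Qed.

Lemma lin_chart_neq0 x A : lin_chart x -> homog_coord x A ->
  forall j, (A *m c) j 0 != 0.
Proof.
move=> /normal_coordP[xB B1] xA j; have [t [t0 ->]] := homog_coord_uniq xB xA.
by rewrite scale_lin_form B1 mulr1.
Qed.

Definition hvar (j : 'I_n) (k : 'I_e.+1) : mpoly.mpoly (n * e.+1) K :=
  mpoly.mpolyX K (mpoly.mnm1 (mxvec_index j k)).

Lemma peval_hvar j k (v : 'rV[K]_(n * e.+1)) : peval (hvar j k) v = vec_mx v j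
  k.
Proof. by rewrite /peval mpoly.mevalXU mxE. Qed.

Definition hlin (j : 'I_n) : mpoly.mpoly (n * e.+1) K :=
  \sum_k hvar j k * mpoly.mpolyC _ (c k 0).

Lemma peval_hlin j (v : 'rV[K]_(n * e.+1)) : peval (hlin j) v = (vec_mx v *m c)
  j 0.
Proof.
rewrite /peval rmorph_sum /= mxE; apply: eq_bigr => k _.
by rewrite mpoly.mevalM mpoly.mevalC [mpoly.meval _ _](peval_hvar j k v).
Qed.

Lemma open_lin_chart : open lin_chart.
Proof.
move=> x v Vx xv; exists (\prod_j hlin j).
have E w : peval (\prod_j hlin j) w = \prod_j (vec_mx w *m c) j 0.
  by rewrite /peval rmorph_prod; apply: eq_bigr => j _; exact: peval_hlin.
rewrite E; split.
  by apply/prodf_neq0 => j _; exact: (lin_chart_neq0 Vx xv).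
by move=> y w yw; rewrite E => /prodf_neq0 h; exists (vec_mx w); split=> // j;
  exact: h.
Qed.

Lemma regular_normal_coord j k :
  regularOn Y lin_chart (fun x => normal_coord x j k).
Proof.
move=> x v Vx xv; exists (hvar j k), (hlin j); rewrite peval_hlin.
split; first exact: (lin_chart_neq0 Vx xv).
move=> y w Vy yw _; rewrite (normal_coordE yw (lin_chart_neq0 Vy yw)) mxE.
by rewrite peval_hvar peval_hlin.
Qed.

(** Normalized coordinates identify the chart with an affine subspace; one more coordinate, holding
    the inverse of [P], turns the principal open subset into a closed set. *)
Lemma affine_principal_open P :
  affine (lin_chart `&` [set x | peval P (mxvec (normal_coord x)) != 0]).
Proof.
set V := _ `&` _; pose N := (n * e.+1)%N.
have oS := open_lin_chart.
have rnc i : regularOn Y lin_chart (fun x => mxvec (normal_coord x) 0 i).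
  case: (mxvec_indexP i) => j k.
  by apply: (eq_regular oS _ (regular_normal_coord j k)) => x _; rewrite mxvecE.
have rP : regularOn Y lin_chart (fun x => peval P (mxvec (normal_coord x))).
  by apply: (regular_peval (multiproj_ringed n e)).
have oV : open V by apply: (open_regular_neq0 (multiproj_ringed n e)).
have VS : V `<=` lin_chart by move=> x [].
pose Z := [set v : 'rV[K]_(N + 1) | (forall j,
  (vec_mx (lsubmx v) *m c) j 0 = 1) /\
  v 0 (rshift N 0) * peval P (lsubmx v) = 1].
(* The inverse map has to be total; outside [Z] its value is arbitrary. *)
have pointP v : exists y : Y, Z v -> homog_coord y (vec_mx (lsubmx v)).
  have [Zv|nZ] := pselect (Z v); last first.
    have [|y _] := @homog_point_exists K n e (const_mx 1); last by exists y.
    by move=> j; apply/eqP => /rowP/(_ 0)/eqP; rewrite !mxE oner_eq0.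
  have [|y yE] := @homog_point_exists K n e (vec_mx (lsubmx v));
    last by exists y.
  move=> j; apply/eqP => vj; have := Zv.1 j.
  rewrite mxE big1 => [/esym/eqP|k _]; first by rewrite oner_eq0.
  have /rowP/(_ k) := vj; rewrite [LHS]mxE [RHS]mxE => ->.
  by rewrite mul0r.
have /choice[g gE] := pointP.
pose f x : 'rV[K]_(N + 1) :=
  row_mx (mxvec (normal_coord x)) (const_mx (peval P (mxvec (normal_coord
    x)))^-1).
exists (N + 1)%N, Z, f; split.
  pose sub (R : mpoly.mpoly N K) : mpoly.mpoly (N + 1) K := mpoly.comp_mpoly
    [tuple mpoly.mpolyX K (mpoly.mnm1 (lshift 1 i)) | i < N] R.
  have subE R (w : 'rV[K]_(N + 1)) : peval (sub R) w = peval R (lsubmx w).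
    rewrite /peval mpoly.comp_mpoly_meval; apply: mpoly.meval_eq => i.
    by rewrite tnth_mktuple mpoly.mevalXU mxE.
  have nZ_open : coord_open (@affine_coord K (N + 1)) (~` Z).
    move=> v _ nZ ->.
    have [v1|/existsNP[j vj]] := pselect (forall j,
      (vec_mx (lsubmx v) *m c) j 0 = 1).
      exists (mpoly.mpolyX K (mpoly.mnm1 (rshift N 0)) * sub P - 1).
      have E w : peval (mpoly.mpolyX K (mpoly.mnm1 (rshift N 0)) * sub P - 1) w
        =
          w 0 (rshift N 0) * peval P (lsubmx w) - 1.
        by rewrite /peval mpoly.mevalB mpoly.mevalM mpoly.mevalXU mpoly.meval1
          -!/(peval _ _) subE.
      rewrite E subr_eq0; split; first by apply/eqP => vP; apply: nZ.
      by move=> y w ->; rewrite E subr_eq0 => /eqP yP [_ /yP].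
    exists (sub (hlin j) - 1).
    have E w : peval (sub (hlin j) - 1) w = (vec_mx (lsubmx w) *m c) j 0 - 1.
      by rewrite /peval mpoly.mevalB mpoly.meval1 -/(peval _ _) subE peval_hlin.
    rewrite E subr_eq0; split; first exact/eqP.
    by move=> y w ->; rewrite E subr_eq0 => /eqP yj [y1 _]; exact/yj/y1.
  rewrite -openC; exact: nZ_open.
exists g; split.
- move=> x [Sx Px]; have [xA A1] := normal_coordP Sx.
  have Zf : Z (f x).
    rewrite /Z /= row_mxKl mxvecK; split=> //.
    by rewrite row_mxEr mxE mulVf.
  split=> //; have := gE _ Zf; rewrite row_mxKl mxvecK => h.
  exact: homog_coord_inj h xA.
- move=> v Zv; have gv := gE v Zv; have [v1 vP] := Zv.
  have Sg : lin_chart (g v).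
    by exists (vec_mx (lsubmx v)); split=> // j; rewrite v1 oner_eq0.
  have nE : mxvec (normal_coord (g v)) = lsubmx v.
    rewrite (normal_coordE gv) => [|j]; last by rewrite v1 oner_eq0.
    rewrite (_ : \matrix_(j, k) _ = vec_mx (lsubmx v)) ?vec_mxK//.
    by apply/matrixP => j k; rewrite mxE v1 divr1.
  have P0 : peval P (lsubmx v) != 0.
    by apply: contra_eq_neq vP => ->; rewrite mulr0 eq_sym oner_eq0.
  split; first by split=> //=; rewrite nE.
  rewrite /f nE -[RHS]hsubmxK; congr row_mx.
  apply/rowP => i; rewrite !mxE !ord1 -[LHS]mul1r -vP mulfK//.
- apply: (morphism_to_affine (multiproj_ringed n e) oV) => // i.
  have rV h : regularOn Y lin_chart h -> regularOn Y V h.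
    exact: regular_restrict.
  rewrite -(splitK i); case: (fintype.split i) => k /=.
    by apply: (eq_regular oV _ (rV _ (rnc k))) => x _; rewrite row_mxEl.
  apply: (eq_regular oV _ (regularV (multiproj_ringed n e) oV (rV _ rP) _)).
    by move=> x _; rewrite row_mxEr mxE.
  by move=> x [].
- refine (@morphism_to_multiproj (affine_space K (N + 1)) n e Z setT g
    (fun v => vec_mx (lsubmx (v : 'rV[K]_(N + 1)))) (affine_ringed _) openT _ _
      _) => //.
  + move=> j k; apply: (eq_regular openT _ (affine_space_coord (lshift 1
      (mxvec_index j k)) openT)).
    by move=> v _; rewrite !mxE.
Qed.
End LinearChart.

End ChartsOfMultiprojectiveSpace.

(** * Regular functions on the line and irreducibility of multiprojective space *)

Section OneVariable.
Context {F : closedFieldType}.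
Implicit Types p q : {poly F}.

Lemma poly_neq0_nonroot p : p != 0 -> exists t, p.[t] != 0.
Proof. by move/poly.closed_nonrootP => [t]; exists t. Qed.

Lemma poly_eq_generic p q r : r != 0 ->
  (forall t, r.[t] != 0 -> p.[t] = q.[t]) -> p = q.
Proof.
move=> r0 pq; apply/eqP; rewrite -subr_eq0; apply/negPn/negP => pq0.
have [|t] := @poly_neq0_nonroot ((p - q) * r); first by rewrite mulf_neq0.
rewrite hornerM mulf_eq0 negb_or hornerD hornerN => /andP[+ rt].
by rewrite pq// subrr eqxx.
Qed.

Definition locally_rational (f : F -> F) : Prop :=
  forall t0, exists p q, q.[t0] != 0 /\ forall t, q.[t] != 0 ->
    f t = p.[t] / q.[t].

(** In lowest terms the denominator of a fraction for [f] has no root: at a root, a fraction valid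
    there would force the numerator to vanish too. Over an algebraically closed field it is then
    constant. *)
Lemma locally_rational_poly f : locally_rational f ->
  exists p, forall t, f t = p.[t].
Proof.
move=> rf; have [p [q [q0 fE]]] := rf 0.
have qn0 : q != 0 by apply: contra_neq q0 => ->; rewrite horner0.
pose g := gcdp p q; pose p' := p %/ g; pose q' := q %/ g.
have pE : p = p' * g by rewrite divpK// dvdp_gcdl.
have qE : q = q' * g by rewrite divpK// dvdp_gcdr.
have cop : coprimep q' p' by rewrite coprimep_sym coprimep_div_gcd// qn0 orbT.
have cross t1 p1 q1 : q1.[t1] != 0 ->
    (forall t, q1.[t] != 0 -> f t = p1.[t] / q1.[t]) -> p' * q1 = p1 * q'.
  move=> q1t1 f1E; apply: (@poly_eq_generic _ _ (q1 * q)).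
    by rewrite mulf_neq0//; apply: contra_neq q1t1 => ->; rewrite horner0.
  move=> t; rewrite hornerM mulf_eq0 negb_or => /andP[q1t qt].
  have := f1E t q1t; rewrite fE// pE qE !hornerM.
  move: qt; rewrite qE hornerM mulf_eq0 negb_or => /andP[q't gt].
  rewrite -mulf_div divff// mulr1 => /eqP; rewrite eqr_div// => /eqP.
  by rewrite mulrC.
have q'_nz t : q'.[t] != 0.
  apply/negP => /eqP q't; have [p1 [q1 [q1t f1E]]] := rf t.
  have /(congr1 (horner^~ t)) := cross t p1 q1 q1t f1E.
  rewrite !hornerM q't mulr0 => /eqP; rewrite mulf_eq0 (negPf q1t) orbF.
  apply/negP; apply: (coprimep_root cop); exact/rootP.
have /size_poly1P[c c0 q'E] : size q' == 1.
  by apply/negPn/negP => /poly.closed_rootP[t /rootP q't];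
    have := q'_nz t; rewrite q't eqxx.
exists (c^-1 *: p') => t; have [p1 [q1 [q1t f1E]]] := rf t.
rewrite f1E// hornerZ; have /(congr1 (horner^~ t)) := cross t p1 q1 q1t f1E.
rewrite !hornerM q'E hornerC => E; apply/eqP.
by rewrite eq_sym mulrC eqr_div// E.
Qed.

(** A section of a line bundle of negative degree on the projective line,
    given in the two standard charts, vanishes. *)
Lemma negative_degree_eq0 (f g : F -> F) (e : nat) : (0 < e)%N ->
  locally_rational f -> locally_rational g ->
  (forall t, t != 0 -> f t * t ^+ e = g t^-1) ->
  (forall t, f t = 0) /\ (forall t, g t = 0).
Proof.
move=> e_gt0 /locally_rational_poly[p fE] /locally_rational_poly[q gE] fg.
pose M := (size q).-1.
(* The reversal of [q], equal to t^M q(1/t): its degree is at most M, whereas p t^(e+M) has larger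
   degree unless p is zero. *)
pose q' := \poly_(i < M.+1) q`_(M - i).
have q'E t : t != 0 -> q'.[t] = t ^+ M * q.[t^-1].
  move=> t0; rewrite horner_poly (@horner_coef_wide _ M.+1) ?leqSpred//.
  rewrite mulr_sumr (reindex_inj rev_ord_inj) /=; apply: eq_bigr => i _.
  have iM : (i <= M)%N by rewrite -ltnS.
  rewrite subSS subKn// mulrCA; congr (_ * _).
  by rewrite exprB ?unitfE// exprVn.
have E : p * 'X^(e + M) = q'.
  apply: (@poly_eq_generic _ _ 'X) => [|t]; first by rewrite polyX_eq0.
  rewrite hornerX => t0; rewrite q'E// -gE -fg// fE hornerM hornerXn exprD.
  by rewrite mulrA mulrC.
have p0 : p = 0.
  apply/eqP/negPn/negP => p0; have := size_poly M.+1 (fun i => q`_(M - i)).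
  rewrite -/q' -E size_mulXn//; apply/negP; rewrite -ltnNge.
  have : (1 + M + 1 <= e + M + size p)%N.
    by rewrite leq_add ?leq_add2r// size_poly_gt0.
  by rewrite add1n addn1.
have q0 : q = 0.
  apply: (@poly_eq_generic _ _ 'X) => [|t]; first by rewrite polyX_eq0.
  rewrite hornerX => t0; rewrite -gE -[t]invrK -fg ?invr_eq0// fE p0.
  by rewrite !horner0 mul0r.
by split=> t; rewrite ?fE ?gE ?p0 ?q0 horner0.
Qed.

Lemma peval_line (N : nat) (P : mpoly.mpoly N F) (u v : 'rV[F]_N) :
  exists p, forall t, peval P (u + t *: v) = p.[t].
Proof.
elim/mpoly_ring_ind: P => [a|i|p q [p' IHp] [q' IHq]|p q [p' IHp] [q' IHq]].
- by exists a%:P => t; rewrite /peval mpoly.mevalC hornerC.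
- exists ((u 0 i)%:P + (v 0 i)%:P * 'X) => t.
  by rewrite /peval mpoly.mevalXU !mxE !hornerE mulrC.
- exists (p' + q') => t.
  by rewrite /peval mpoly.mevalD hornerD -IHp -IHq.
- exists (p' * q') => t.
  by rewrite /peval mpoly.mevalM hornerM -IHp -IHq.
Qed.

(** On the line joining coordinate vectors of two points, the polynomials describing the two open
    sets become non-zero polynomials in one variable, which have a common non-root. *)
Lemma multiproj_irreducible n e (O1 O2 : set (multiproj F n e)) :
  open O1 -> open O2 -> O1 !=set0 -> O2 !=set0 -> (O1 `&` O2) !=set0.
Proof.
move=> oO1 oO2 [y1 Oy1] [y2 Oy2].
have [A1 yA1] := homog_coord_exists y1; have [A2 yA2] := homog_coord_exists y2.
have c1 : multiproj_coord y1 (mxvec A1) by rewrite /multiproj_coord mxvecK.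
have c2 : multiproj_coord y2 (mxvec A2) by rewrite /multiproj_coord mxvecK.
have [P1 [P1A P1E]] := oO1 _ _ Oy1 c1; have [P2 [P2A P2E]] := oO2 _ _ Oy2 c2.
have [p1 p1E] := peval_line P1 (mxvec A1) (mxvec A2 - mxvec A1).
have [p2 p2E] := peval_line P2 (mxvec A1) (mxvec A2 - mxvec A1).
have /choice[k kE] : forall j, exists k, A1 j k != 0.
  move=> j; have [/eqP A1j _] := yA1 j; apply/not_existsP => h; apply: A1j.
  by apply/rowP => k; rewrite !mxE; apply/eqP/negPn/negP; exact: h.
(* A non-root of [r j] keeps row [j] non-zero, so that the vector chosen on the line represents a
   point. *)
pose r j := (A1 j (k j))%:P + (A2 j (k j) - A1 j (k j))%:P * 'X.
have p1_neq0 : p1 != 0.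
  apply: contra_neq P1A => p10; have := p1E 0.
  by rewrite scale0r addr0 p10 horner0.
have p2_neq0 : p2 != 0.
  apply: contra_neq P2A => p20; have := p2E 1.
  by rewrite scale1r addrC subrK p20 horner0.
have r_neq0 : \prod_j r j != 0.
  apply/prodf_neq0 => j _; apply: contra_neq (kE j) => rj.
  by have := congr1 (horner^~ 0) rj; rewrite !hornerE.
have [|t] := @poly_neq0_nonroot (p1 * p2 * \prod_j r j).
  by rewrite !mulf_neq0.
rewrite !hornerM !mulf_eq0 !negb_or -p1E -p2E => /andP[/andP[P1t P2t] rt].
set v := _ + _ in P1t P2t.
have [|y yA] := @homog_point_exists F n e (vec_mx v).
  move=> j; apply/eqP => /rowP/(_ (k j)); rewrite !mxE.
  move: rt; rewrite horner_prod => /prodf_neq0/(_ j isT).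
  rewrite !hornerE !mxvecE => /eqP rt h; apply: rt; rewrite -[RHS]h.
  by rewrite mulrC.
by exists y; split; [exact: P1E P1t | exact: P2E P2t].
Qed.
End OneVariable.

(** * Sections of line bundles on products of projective lines *)

Section Sections.
Context {F : closedFieldType} {n : nat}.
Implicit Types (r : 'I_n -> int) (A : 'M[F]_(n, 2)).

Definition first_form : 'cV[F]_2 := delta_mx 0 0.

Lemma first_formE A j : (A *m first_form) j 0 = A j 0.
Proof. by rewrite -colE mxE. Qed.

Definition std_chart : set (P1n F n) := lin_chart first_form.

Lemma std_chart_nonempty : std_chart !=set0.
Proof.
have [|x xA] := @homog_point_exists F n 1 (const_mx 1).
  by move=> j; apply/eqP => /rowP/(_ 0)/eqP; rewrite !mxE oner_eq0.
by exists x, (const_mx 1); split=> // j; rewrite first_formE mxE oner_eq0.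
Qed.

Definition monomial (a b : 'I_n -> nat) (A : 'M[F]_(n, 2)) : F :=
  \prod_j (A j 0 ^+ a j * A j 1 ^+ b j).

Lemma monomial_section r a b (V : set (P1n F n)) :
  (forall j, r j = (a j + b j)%N%:Z) -> O_section r V (monomial a b).
Proof.
move=> rE; split.
  move=> x v _ _; exists (\prod_j (hvar j 0 ^+ a j * hvar j 1 ^+ b j)), 1.
  rewrite /peval mpoly.meval1 oner_eq0; split=> // y w _ _ _.
  rewrite mpoly.meval1 divr1 rmorph_prod; apply: eq_bigr => j _.
  rewrite rmorphM !rmorphXn /=.
  by have E k : mpoly.meval (fun i => w 0 i) (hvar j k) = vec_mx w j k :=
    peval_hvar j k w; rewrite !E.
move=> x A t _ _ _; rewrite /monomial -big_split; apply: eq_bigr => j _.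
by rewrite !mxE !exprMn rE /= -exprnP exprD mulrACA.
Qed.

Lemma locally_rational_section r (s : 'M[F]_(n, 2) -> F)
  (u v : 'rV[F]_(n * 2)) : O_section r setT s ->
  (forall t j, row j (vec_mx (u + t *: v)) != 0) ->
  locally_rational (fun t => s (vec_mx (u + t *: v))).
Proof.
move=> [rs _] uv0 t0; have [x xA] := homog_point_exists (uv0 t0).
have [p [q [qx sE]]] := rs x (u + t0 *: v) I xA.
have [p' p'E] := peval_line p u v; have [q' q'E] := peval_line q u v.
exists p', q'; rewrite -q'E; split=> // t; rewrite -q'E -p'E => qt.
have [y yA] := homog_point_exists (uv0 t).
exact: (sE y).
Qed.

(** Fixing all coordinates but the j-th pair restricts [s] to a section of O(r_j) on a projective
    line; if r_j were negative, it would vanish, in particular at [x]. *)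
Lemma global_section_ge0 r (s : 'M[F]_(n, 2) -> F) (x : P1n F n) A :
  O_section r setT s -> homog_coord x A -> s A != 0 -> forall j, 0 <= r j.
Proof.
move=> Os xA sA j; rewrite leNgt; apply/negP => rj.
pose B (a b : F) : 'M[F]_(n, 2) :=
  \matrix_(i, k) if i == j then (if k == 0 then a else b) else A i k.
have I2 (k : 'I_2) : (k = 0) + (k = 1).
  by case: (eqVneq k 0) => [->|k0]; [left|right; case: k k0 => -[|[|//]] //
    ? _; apply/val_inj].
have BA : A = B (A j 0) (A j 1).
  apply/matrixP => i k; rewrite mxE; case: eqP => // ->.
  by have [->|->] := I2 k.
have B_row a b i : (a != 0) || (b != 0) -> row i (B a b) != 0.
  move=> ab; have [->|ij] := eqVneq i j; last first.
    have [Ai _] := xA i; apply: contra_neq Ai => /rowP BE; apply/rowP => k.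
    by have := BE k; rewrite !mxE (negPf ij).
  apply/eqP => /rowP BE; move: ab (BE 0) (BE 1); rewrite !mxE eqxx /=.
  by move=> + a0 b0; rewrite a0 b0 eqxx.
have B_scale c a b : c != 0 -> (a != 0) || (b != 0) ->
    s (B (c * a) (c * b)) = c ^ r j * s (B a b).
  move=> c0 ab; have [y yB] := homog_point_exists (fun i => B_row a b i ab).
  have [_ hom] := Os.
  have := hom y (B a b) (fun i => if i == j then c else 1) I yB.
  rewrite (bigD1 j) //= eqxx big1 => [|i /negPf->]; last by rewrite exp1rz.
  rewrite mulr1 => <-; last by move=> i; case: ifP => // _; rewrite oner_eq0.
  congr s; apply/matrixP => i k; rewrite !mxE; case: eqP => _;
    last by rewrite mul1r.
  by case: ifP.
(* Row [j] moves along an affine line while the other rows stay fixed, so that the one-variable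
   results apply. *)
pose L (a0 b0 a1 b1 : F) t := mxvec (B a0 b0) +
  t *: mxvec (\matrix_(i, k) if i == j then (if k == 0 then a1 else b1) else 0).
have LE a0 b0 a1 b1 t : vec_mx (L a0 b0 a1 b1 t) = B (a0 + t * a1) (b0 + t *
  b1).
  apply/matrixP => i k; rewrite linearD linearZ /= !mxvecK !mxE.
  by case: eqP => _; [case: ifP|rewrite mulr0 addr0].
have loc a0 b0 a1 b1 : (forall t, (a0 + t * a1 != 0) || (b0 + t * b1 != 0)) ->
    locally_rational (fun t => s (B (a0 + t * a1) (b0 + t * b1))).
  move=> h; have := @locally_rational_section r s (mxvec (B a0 b0)) _ Os.
  move=> /(_ (mxvec (\matrix_(i,
    k) if i == j then (if k == 0 then a1 else b1) else 0))) H.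
  have {}H := H (fun t i => _); move=> t0.
  have [|p [q pqE]] := H _ t0.
    by move=> t i; rewrite -/(L a0 b0 a1 b1 t) LE; exact: B_row.
  exists p, q; have [q0 E] := pqE; split=> // t qt.
  by rewrite -E// -/(L a0 b0 a1 b1 t) LE.
pose f t := s (B 1 t); pose g t := s (B t 1).
have rf : locally_rational f.
  have := loc 1 0 0 1; rewrite /f => h t0.
  have [|p [q [q0 E]]] := h _ t0; first by move=> t;
    rewrite mulr0 addr0 oner_eq0.
  by exists p, q; split=> // t qt; rewrite -E// mulr0 addr0 mulr1 add0r.
have rg : locally_rational g.
  have := loc 0 1 1 0; rewrite /g => h t0.
  have [|p [q [q0 E]]] := h _ t0.
    by move=> t; rewrite mulr0 addr0 oner_eq0 orbT.
  by exists p, q; split=> // t qt; rewrite -E// mulr0 addr0 mulr1 add0r.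
have [e e_gt0 rjE] : exists2 e : nat, (0 < e)%N & r j = - e%:Z.
  by exists `|r j|%N; [rewrite absz_gt0 lt_eqF | rewrite abszE ltr0_norm//
    opprK].
have [|f0 g0] := negative_degree_eq0 e_gt0 rf rg.
  move=> t t0; have := B_scale t t^-1 1 t0; rewrite oner_eq0 orbT divff// mulr1.
  by rewrite /f /g => ->//; rewrite rjE mulrAC -exprnN mulVf ?expf_neq0// mul1r.
move/negP: sA; apply; apply/eqP; rewrite BA.
(* The j-th point lies in one of the two charts: its coordinates are rescaled to (0, 1) or to (1,
   t). *)
have [a0|a0] := eqVneq (A j 0) 0.
  have b0 : A j 1 != 0.
    have [Aj _] := xA j; apply: contra_neq Aj => b0; apply/rowP => k.
    by rewrite !mxE; have [->|->] := I2 k.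
  rewrite a0; have := B_scale (A j 1) 0 1 b0;
    rewrite mulr0 mulr1 oner_eq0 orbT => ->//.
  by rewrite -/(g 0) g0 mulr0.
have := B_scale (A j 0) 1 (A j 1 / A j 0) a0.
by rewrite mulr1 mulrCA divff// mulr1 oner_eq0 => ->//;
  rewrite -/(f _) f0 mulr0.
Qed.
End Sections.

(** * Eigenforms *)

Section LinearCharacters.
Context {C : numClosedFieldType} {gT : finGroupType}.
Implicit Types chi : gT -> C.

Lemma irr_char_linear chi : abelian [set: gT]%SET -> irr_char chi ->
  chi 1%g = 1 /\ forall g h, chi (g * h)%g = chi g * chi h.
Proof.
move=> abG [k [rG [irrG chiE]]].
have k1 : k = 1%N.
  exact: (mx_irr_abelian_linear (@group_closure_closed_field C gT _) irrG abG).
subst k; split; first by rewrite chiE repr_mx1 mxtrace1.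
by move=> g h; rewrite !chiE repr_mxM ?inE// !trace_mx11 mxE big_ord1.
Qed.

Lemma trivial_irr_char : irr_char (fun _ : gT => 1 : C).
Proof.
have r1 : mx_repr [set: gT]%G (fun _ : gT => 1%:M : 'M[C]_1).
  by split=> // g h _ _; rewrite mulmx1.
exists 1%N, (MxRepresentation r1); split=> [|g]; last by rewrite mxtrace1.
exact/mx_abs_irrW/linear_mx_abs_irr.
Qed.

Lemma linear_char_conj chi g : chi 1%g = 1 ->
  (forall g h, chi (g * h)%g = chi g * chi h) -> (chi g)^* = chi g^-1%g.
Proof.
move=> chi1 chiM.
have chiX e : chi (g ^+ e)%g = chi g ^+ e.
  by elim: e => [|e IH]; rewrite ?expg0 ?expr0// expgS exprS chiM IH.
have norm1 : `|chi g| = 1.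
  apply/eqP; rewrite -(@pexpr_eq1 _ _ #[g]%g)// -normrX -chiX expg_order chi1.
  by rewrite normr1.
have chig : chi g != 0 by rewrite -normr_eq0 norm1 oner_eq0.
apply: (mulfI chig); rewrite -chiM mulgV chi1 -normCK norm1.
by rewrite expr1n.
Qed.
End LinearCharacters.

Section Eigenforms.
Context {C : numClosedFieldType} {gT : finGroupType} {X : funspace C}.
Context (act : {action gT &-> X}) {d : nat} (m : nat) (m_gt0 : (0 < m)%N).
Context (ringX : ringed X) (dimX : forall x : X, tangent_dim x d).
Context (affX : forall x : X, exists U : set X, [/\ open U, U x & affine U]).

Definition eigenform (chi : gT -> C) (w : form X d) : Prop :=
  pluriform m setT w /\ forall g, form_eq setT (pullback (act^~ g) w)
    (fun x D => chi g * w x D).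

Lemma pluriform_lincomb (N : nat) (s : 'I_N -> form X d) (a : 'I_N -> C) :
  (forall i, pluriform m setT (s i)) ->
  pluriform m setT (fun x D => \sum_i a i * s i x D).
Proof.
move=> ps; suff h (l : seq 'I_N) :
  pluriform m setT (fun x D => \sum_(i <- l) a i * s i x D) by exact: h.
elim: l => [|i l IH].
  rewrite (_ : (fun x D => _) = (fun _ _ => 0)); first exact: pluriform0.
  by apply/funext => x; apply/funext => D; rewrite big_nil.
rewrite (_ : (fun x D => _) =
    (fun x D => a i * s i x D + \sum_(j <- l) a j * s j x D)).
  by apply: pluriform_linear => //; exact: openT.
by apply/funext => x; apply/funext => D; rewrite big_cons.
Qed.

(** Up to a factor, [e] is the projector onto the chi-isotypic part. Its trace is a multiple of the
    inner product of [phi] and [chi], so [e] is non-zero and one of its rows is the coordinate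
    vector of an eigenform. *)
Lemma constituent_eigenform phi chi : abelian [set: gT]%SET ->
  canonical_character act d m phi -> irr_constituent phi chi ->
  exists w, eigenform chi w /\ exists x, nonvanishing w x.
Proof.
move=> abG [N [s [rG [[ps s_uniq] sE phiE]]]] [irr_chi].
have [chi1 chiM] := irr_char_linear abG irr_chi.
rewrite mulf_eq0 negb_or => /andP[_ chi_neq0].
pose e := \sum_g (chi g)^* *: rG g.
have e_neq0 : e != 0.
  apply: contra_neq chi_neq0 => e0;
    rewrite -[RHS](mxtrace0 C N) -e0 /e linear_sum.
  by apply: eq_bigr => g _; rewrite linearZ /= phiE mulrC.
have eM h : e *m rG h = chi h *: e.
  rewrite /e mulmx_suml scaler_sumr (reindex_inj (mulIg h^-1%g)) /=.
  apply: eq_bigr => g _; rewrite -scalemxAl -repr_mxM ?inE// mulgKV scalerA.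
  congr (_ *: _); rewrite !linear_char_conj// invMg invgK chiM.
  by rewrite mulrC.
have [i ei] : exists i, row i e != 0.
  apply/not_existsP => h; move/negP: e_neq0; apply; apply/eqP/row_matrixP => i.
  by rewrite row0; apply/eqP/negPn/negP; exact: h.
pose w : form X d := fun x D => \sum_j e i j * s j x D.
have pw : pluriform m setT w by exact: pluriform_lincomb.
exists w; split; first split=> // g x D _ tD.
  rewrite /pullback /w.
  transitivity (\sum_j \sum_k (e i j * rG g j k) * s k x D).
    apply: eq_bigr => j _; rewrite [X in _ * X](sE g j x D I tD) mulr_sumr.
    by apply: eq_bigr => k _; rewrite mulrA.
  rewrite exchange_big mulr_sumr; apply: eq_bigr => k _.
  rewrite -mulr_suml mulrA; congr (_ * _).
  by have /matrixP/(_ i k) := eM g; rewrite !mxE.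
(* If the eigenform vanished everywhere, uniqueness of the coordinates of the zero form would make
   the row zero. *)
apply/not_existsP => h; case/negP: ei; apply/eqP.
have p0 : pluriform m setT ((fun _ _ => 0) : form X d) by exact: pluriform0.
have [c [_ c_uniq]] := s_uniq _ p0.
rewrite -(c_uniq (row i e)) ?(c_uniq 0)//.
  by move=> x D _ _; rewrite big1// => j _; rewrite mxE mul0r.
move=> x D _ tD; transitivity (w x D); last by apply: eq_bigr => j _;
  rewrite mxE.
by apply/eqP; rewrite eq_sym; apply/negPn/negP => wx; apply: (h x); exists D.
Qed.
End Eigenforms.

(** * Eigenforms as sections of O(r) *)

Section Eigensheaves.
Context {C : numClosedFieldType} {gT : finGroupType} {n : nat}.
Context {X : funspace C} {act : {action gT &-> X}} {f : X -> P1n C n}.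
Context {d m : nat} {chi : gT -> C} {r : 'I_n -> int}.
Context {phi : set (P1n C n) -> ('M[C]_(n, 2) -> C) -> form X d}.
Context (iso : eigensheaf_iso act f m chi r phi).

Lemma zero_section (V : set (P1n C n)) : O_section r V (fun=> 0).
Proof.
split=> [x v _ _|x A t _ _ _]; last by rewrite mulr0.
exists 0, 1; rewrite /peval mpoly.meval1 oner_eq0; split=> // y w _ _ _.
by rewrite mpoly.meval0 mul0r.
Qed.

(** Linearity with h = 1 and all sections zero says that the image equals its own double. *)
Lemma iso_zero V : open V ->
  form_eq (f @^-1` V) (phi V (fun=> 0)) (fun _ _ => 0).
Proof.
move=> oV x D Vx tD; have zV := zero_section V.
have r1 : regularOn (P1n C n) V (fun=> 1).
  by apply: (regular_cst (multiproj_ringed n 1)).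
have := iso_linear iso oV r1 zV zV zV.
move=> /(_ _ x D Vx tD) E.
have {}E : phi V (fun=> 0) x D = phi V (fun=> 0) x D + phi V (fun=> 0) x D.
  by rewrite [LHS]E ?mul1r// => y A _ _; rewrite addr0.
by apply: (addrI (phi V (fun=> 0) x D)); rewrite addr0.
Qed.

Lemma section_neq0_nonvanishing s : O_section r setT s ->
  (exists x, nonvanishing (phi setT s) x) <->
  (exists x A, homog_coord x A /\ s A != 0).
Proof.
move=> Os; have zV := zero_section setT; have z := iso_zero openT.
have inj := iso_inj iso openT Os zV.
split; apply: contraPP => /forallNP h.
  case=> x [D [tD]]; rewrite (_ : phi setT s x D = 0) ?eqxx//.
  rewrite -(z x D)//; move: x D {tD} (tD) => x D tD; apply: inj.2 => //.
  move=> y A _ yA; apply/eqP/negPn/negP => sA.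
  by apply: (h y); exists A.
case=> x [A [xA]]; rewrite (inj.1 _ x A)// ?eqxx//.
move=> y D _ tD; rewrite z//; apply/eqP/negPn/negP => sy.
by apply: (h y); exists D.
Qed.

Lemma eigenform_degree_ge0 (w : form X d) x : eigenform act m chi w ->
  nonvanishing w x ->
  forall j, 0 <= r j.
Proof.
move=> [pw ew] [D [tD wD]].
have [s [Os sE]] := iso_onto iso openT (conj pw ew).
have /(section_neq0_nonvanishing Os)[y [A [yA sA]]] :
    exists y, nonvanishing (phi setT s) y.
  by exists x, D; split=> //; rewrite sE.
exact: global_section_ge0 Os yA sA.
Qed.

(** [a] comes from the product of the powers of the first coordinates, [b] from exchanging one
    factor x_(j,0) for x_(j,1). On the standard chart the two sections differ by the j-th affine
    coordinate, and linearity over regular functions carries this to the forms. *)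
Lemma eigenform_monomials : (forall j, 0 <= r j) ->
  exists a : form X d, [/\ eigenform act m chi a, exists x, nonvanishing a x &
    forall j, 1 <= r j -> exists b : form X d, pluriform m setT b /\
      forall x D, @std_chart C n (f x) -> (forall i, tangent x (D i)) ->
        b x D = normal_coord (first_form : 'cV[C]_2) (f x) j 1 * a x D].
Proof.
move=> r_ge0; pose s := @monomial C n (fun i => `|r i|%N) (fun=> 0%N).
have Os V : O_section r V s.
  by apply: monomial_section => i; rewrite addn0 gez0_abs.
exists (phi setT s); split.
- by have [pa ea] := iso_section iso openT (Os setT); split.
- apply/(section_neq0_nonvanishing (Os setT)).
  have [x [A [xA A0]]] := @std_chart_nonempty C n.
  exists x, A; split=> //; apply/prodf_neq0 => j _.
  by rewrite expr0 mulr1 expf_neq0// -first_formE.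
move=> j rj; pose s' := @monomial C n (fun i => `|r i| - (i == j))%N (fun i =>
  i == j).
have Os' V : O_section r V s'.
  apply: monomial_section => i; case: eqVneq => [->|_] /=.
    rewrite subnK ?gez0_abs//.
    by rewrite absz_gt0 gt_eqF// (lt_le_trans _ rj).
  by rewrite subn0 addn0 gez0_abs.
exists (phi setT s'); split; first by have [] :=
  iso_section iso openT (Os' setT).
move=> x D Vx tD; have oV : open (@std_chart C n) := @open_lin_chart _ _ _ _.
have := iso_linear iso oV (regular_normal_coord (c :=
  first_form) j 1) (Os _) (zero_section _) (Os' _).
move=> /(_ _ x D Vx tD); rewrite (iso_zero oV)// addr0.
rewrite (iso_restrict iso openT oV (@subsetT _ _) (Os setT))//.
rewrite (iso_restrict iso openT oV (@subsetT _ _) (Os' setT))//; apply.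
move=> y A Vy yA; have A0 := lin_chart_neq0 Vy yA.
rewrite (normal_coordE yA A0) mxE first_formE addr0 /s /s' /monomial (bigD1
  j)//=.
rewrite [in RHS](bigD1 j)//= mulrA; congr (_ * _).
  rewrite eqxx expr0 mulr1 expr1.
  rewrite -[in RHS](@subnK 1 `|r j|%N); last first.
    by rewrite absz_gt0 gt_eqF// (lt_le_trans _ rj).
  by rewrite addn1 exprS; field; rewrite -first_formE.
by apply: eq_bigr => i /negPf->; rewrite subn0.
Qed.
End Eigensheaves.

(** * The cover *)

Section ActionOnType.
Context {gT : finGroupType} {T : Type} (act : {action gT &-> T}).

(** [actM] and [act1] are restricted to actions on finite types. *)
Lemma action_mul x g h : act x (g * h)%g = act (act x g) h.
Proof. by case: act => to [to_inj toM] /=; apply: toM; rewrite inE. Qed.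

Lemma action1 x : act x 1%g = x.
Proof.
have injA : injective (act^~ 1%g) by case: act => to [to_inj toM];
  exact: to_inj.
by apply: injA; rewrite -action_mul mulg1.
Qed.
End ActionOnType.

Section CoverGeometry.
Context {C : numClosedFieldType} {gT : finGroupType} {n : nat}.
Context {X : funspace C} {act : {action gT &-> X}} {f : X -> P1n C n}.
Context {d : nat} (m : nat) (m_gt0 : (0 < m)%N).
Context (ringX : ringed X) (dimX : forall x : X, tangent_dim x d).
Context (affX : forall x : X, exists U : set X, [/\ open U, U x & affine U]).
Context (cover : finite_abelian_cover act f).

(** Comparing a form with itself already shows that it stays non-vanishing nearby. *)
Lemma open_nonvanishing (w : form X d) : pluriform m setT w ->
  open (nonvanishing w).
Proof.
move=> pw; rewrite openE => x nx.
have [V [k [oV Vx _ VE]]] :=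
  pluriform_ratio ringX dimX affX m_gt0 openT I pw pw nx.
rewrite /interior nbhsE; exists V => //.
by move=> y /VE[].
Qed.

Lemma act_morphism g : morphism_on (Y := X) setT (act^~ g).
Proof. by case: cover => _ _ _ []. Qed.

Lemma tangent_act x g (D : tvec X) : tangent x D ->
  tangent (act x g) (fun h => D (h \o act^~ g)).
Proof.
move=> tD V h k oV Vx rh rk; have mg := act_morphism g.
have oW := morphism_setT_open mg oV.
have rhg := morphism_setT_regular mg oV rh.
have rkg := morphism_setT_regular mg oV rk.
have [E L M] := tD _ _ _ oW Vx rhg rkg; split=> //.
by move=> hk; apply: E => y Vy; exact: hk.
Qed.

Lemma cover_fibre x x' : f x = f x' <-> exists g, x' = act x g.
Proof. by case: cover => _ _ _ [_ _ [_ h _ _]]; exact: h. Qed.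

Lemma cover_act x g : f (act x g) = f x.
Proof. by apply/esym/cover_fibre; exists g. Qed.

Lemma nonvanishing_act chi (w : form X d) x g : eigenform act m chi w ->
  chi g != 0 -> nonvanishing w x -> nonvanishing w (act x g).
Proof.
move=> [_ ew] chig [D [tD wD]]; exists (fun i h => D i (h \o act^~ g)); split.
  by move=> i; exact: tangent_act.
by rewrite [w _ _](ew g x D I tD) mulf_neq0.
Qed.

(** The preimage of the image is the union of the translates of [O], and the base carries the
    quotient topology. *)
Lemma open_cover_image (O : set X) : open O -> open (f @` O).
Proof.
move=> oO; case: cover => _ _ _ [_ _ [_ _ oquot _]]; apply: oquot.
rewrite (_ : _ @^-1` _ = \bigcup_(g in [set: gT]) [set x | O (act x g)]).
  apply: bigcup_open => g _.
  exact: (morphism_setT_open (act_morphism g) oO).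
apply/seteqP; split=> x.
  move=> [x' Ox' /esym/cover_fibre[g x'E]].
  by exists g => //=; rewrite -x'E.
by move=> [g _ /= Og]; exists (act x g) => //; exact: cover_act.
Qed.

Lemma open_cover_preimage (V : set (P1n C n)) : open V -> open (f @^-1` V).
Proof.
by move=> oV; case: cover => _ _ [mf _] _; exact: morphism_setT_open.
Qed.

Lemma dense_cover_preimage (V : set (P1n C n)) : open V -> V !=set0 ->
  dense (f @^-1` V).
Proof.
move=> oV V0 O [x Ox] oO.
have [|y [[x' Ox' <-] Vx']] :=
  multiproj_irreducible (open_cover_image oO) oV _ V0.
  by exists (f x), x.
by exists x'.
Qed.

Lemma regular_cover_descend (V : set (P1n C n)) (G : X -> C) : open V ->
  regularOn X (f @^-1` V) G -> (forall x g, V (f x) -> G (act x g) = G x) ->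
  exists h, regularOn (P1n C n) V h /\ forall x, V (f x) -> G x = h (f x).
Proof.
move=> oV rG invG; case: (cover) => _ _ _ [_ _ [surj _ _ quot]].
have /choice[lift liftE] := surj.
have GE x : V (f x) -> G x = G (lift (f x)).
  move=> Vx; have /cover_fibre[g ->] : f x = f (lift (f x)) by rewrite liftE.
  by rewrite invG.
exists (G \o lift); split=> //.
apply: quot => //; apply: eq_regular rG; first exact: open_cover_preimage.
by move=> x Vx /=; rewrite -GE.
Qed.

Lemma multiproj_irreducible_finite (I : finType) (O : I -> set (P1n C n)) W :
  (forall i, open (O i)) -> (forall i, O i !=set0) -> open W -> W !=set0 ->
  (W `&` [set y | forall i, O i y]) !=set0.
Proof.
move=> oO O0 oW W0.
suff H (s : seq I) : [/\ open (W `&` [set y | forall i, i \in s -> O i y]) &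
    (W `&` [set y | forall i, i \in s -> O i y]) !=set0].
  have [_ [y [Wy h]]] := H (enum I).
  by exists y; split=> // i; apply: h; rewrite mem_enum.
elim: s => [|i s [oIH IH]].
  by rewrite (_ : [set y | _] = setT) ?setIT//; apply/seteqP; split.
have -> : W `&` [set y | forall k, k \in i :: s -> O k y] =
    O i `&` (W `&` [set y | forall k, k \in s -> O k y]).
  apply/seteqP; split=> y.
    move=> [Wy h]; split; first by apply: h; rewrite mem_head.
    by split=> // k ks; apply: h; rewrite inE ks orbT.
  by move=> [Oy [Wy h]]; split=> // k; rewrite inE => /orP[/eqP->//|]; exact: h.
by split; [exact: openI | exact: multiproj_irreducible].
Qed.

(** The non-vanishing conditions are pushed down to the base and cut out by one polynomial [P],
    because finiteness of the cover makes preimages of affine open sets affine. *)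
Lemma cover_affine_open (I : finType) (w : I -> form X d) (chi : I -> gT -> C) :
  (forall i, eigenform act m (chi i) (w i)) -> (forall i g, chi i g != 0) ->
  (forall i, exists x, nonvanishing (w i) x) ->
  exists V : set (P1n C n), [/\ open V, V !=set0, V `<=` std_chart,
    affine (f @^-1` V) & forall i x, V (f x) -> nonvanishing (w i) x].
Proof.
move=> ew chi0 w0; pose O i := f @` nonvanishing (w i).
have oO i : open (O i) by apply/open_cover_image/open_nonvanishing; have [] :=
  ew i.
have O0 i : O i !=set0 by have [x nx] := w0 i; exists (f x), x.
have oS : open (@std_chart C n) := @open_lin_chart _ _ _ _.
have [y [Sy Oy]] := multiproj_irreducible_finite oO O0 oS (@std_chart_nonempty
  C n).
have oOO : open [set y | forall i, O i y] by exact: finite_open_bigcap.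
have nrmE (z : P1n C n) : std_chart z ->
    multiproj_coord z (mxvec (normal_coord (first_form : 'cV[C]_2) z)).
  by move=> /normal_coordP[zA _]; rewrite /multiproj_coord mxvecK.
have [P [Py PO]] := oOO y _ Oy (nrmE y Sy).
pose V : set (P1n C n) := std_chart `&`
  [set z | peval P (mxvec (normal_coord (first_form : 'cV[C]_2) z)) != 0].
have ringY : ringed (P1n C n) := multiproj_ringed n 1.
have oV : open V.
  apply: (open_regular_neq0 ringY oS); apply: (regular_peval ringY) => // i.
  case: (mxvec_indexP i) => j k.
  apply: (eq_regular oS _ (regular_normal_coord (c := first_form) j k)) => z _.
  by rewrite mxvecE.
exists V; split=> //.
- by exists y.
- by move=> z [].
- by case: cover => _ _ [_ fin] _; have [] :=
    fin V oV (affine_principal_open _ _).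
(* [w i] is non-zero at some point of the fibre, and the group carries this to the whole fibre. *)
- move=> i x [Sx Px]; have [x' nx'] := PO _ _ (nrmE _ Sx) Px i.
  move=> /cover_fibre[g ->]; exact: nonvanishing_act (ew i) _ nx'.
Qed.
End CoverGeometry.

(** * The pluricanonical map *)

Section CanonicalMap.
Context {C : numClosedFieldType} {gT : finGroupType} {n : nat}.
Context {X : funspace C} {act : {action gT &-> X}} {f : X -> P1n C n}.
Context {d m : nat} (m_gt0 : (0 < m)%N).
Context (ringX : ringed X) (dimX : forall x : X, tangent_dim x d).
Context (affX : forall x : X, exists U : set X, [/\ open U, U x & affine U]).
Context (cover : finite_abelian_cover act f).
Context {N : nat} {s : 'I_N.+1 -> form X d} (sB : H0_basis m s).
Context {I : finType} (i0 : I) {w : I -> form X d} {chi : I -> gT -> C}.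
Context (ew : forall i, eigenform act m (chi i) (w i)).
Context (chi_neq0 : forall i g, chi i g != 0) (chi1 : forall i, chi i 1%g = 1).
Context {V : set (P1n C n)} (oV : open V) (V_std : V `<=` std_chart).
Context (V_nv : forall i x, V (f x) -> nonvanishing (w i) x).
Context (coord_ratio : forall j, exists i (b : form X d), pluriform m setT b /\
  forall x D, std_chart (f x) -> (forall i, tangent x (D i)) ->
    b x D = normal_coord (first_form : 'cV[C]_2) (f x) j 1 * w i x D).
Context (separating : forall h, h <> 1%g -> exists i, chi i h != chi i0 h).

Local Notation U := (f @^-1` V).
Local Notation PN := (projective_space C N).

Lemma open_domain : open U. Proof. exact: open_cover_preimage cover _ oV. Qed.

Let oU := open_domain.
Let ringPN : ringed PN := multiproj_ringed 1 N.

(** The function u / w_0. Its value is unique on U; the default 0 is taken only where no quotient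
    exists. *)
Definition ratio (u : form X d) (x : X) : C :=
  xget 0 [set k | forall D, (forall i, tangent x (D i)) ->
    u x D = k * w i0 x D].

Lemma ratio_eq u x k : U x ->
  (forall D, (forall i, tangent x (D i)) -> u x D = k * w i0 x D) ->
  ratio u x = k.
Proof.
move=> Ux uE; rewrite /ratio; case: xgetP => [l _ lE|/(_ k)/(_ uE)//].
have [D [tD wD]] := V_nv i0 Ux.
by apply: (mulIf wD); rewrite -lE// uE.
Qed.

Lemma ratioP u x D : pluriform m setT u -> U x -> (forall i, tangent x (D i)) ->
  u x D = ratio u x * w i0 x D.
Proof.
move=> pu Ux tD.
have [W [k [oW Wx rk kE]]] := pluriform_ratio ringX dimX affX m_gt0 openT
  Logic.I (ew i0).1 pu (V_nv i0 Ux).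
by rewrite (ratio_eq (k := k x) Ux) ?(kE x Wx).2// => D' tD';
  rewrite (kE x Wx).2.
Qed.

Lemma regular_ratio u : pluriform m setT u -> regularOn X U (ratio u).
Proof.
move=> pu; apply: regular_local => // x Ux.
have [W [k [oW Wx rk kE]]] := pluriform_ratio ringX dimX affX m_gt0 openT
  Logic.I (ew i0).1 pu (V_nv i0 Ux).
exists W, k; split=> // y Uy Wy; apply: ratio_eq => // D tD.
exact: (kE y Wy).2.
Qed.

Lemma ratio_neq0 i x : U x -> ratio (w i) x != 0.
Proof.
move=> Ux; have [D [tD wD]] := V_nv i Ux.
by apply: contra_neq wD => r0; rewrite (ratioP (ew i).1 Ux tD) r0 mul0r.
Qed.

(** Both forms are evaluated at the tangent vectors pushed forward by [g], where each is multiplied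
    by its character. *)
Lemma ratio_act i x g : U x ->
  ratio (w i) (act x g) = chi i g / chi i0 g * ratio (w i) x.
Proof.
move=> Ux; have [D [tD wD]] := V_nv i0 Ux.
have Ugx : U (act x g) by rewrite /= (cover_act cover).
have tDg j := tangent_act cover (g := g) (tD j).
have := ratioP (ew i).1 Ugx tDg.
rewrite [w i _ _]((ew i).2 g x D Logic.I tD) [w i0 _ _]((ew i0).2 g x D Logic.I
  tD).
rewrite (ratioP (ew i).1 Ux tD) !mulrA => /(mulIf wD) E.
by rewrite mulrAC E mulfK.
Qed.

Lemma ratio_lincomb u : pluriform m setT u -> exists e : 'rV[C]_N.+1,
  forall x, U x -> ratio u x = \sum_i e 0 i * ratio (s i) x.
Proof.
move=> pu; have [ps s_gen] := sB; have [e [eE _]] := s_gen u pu.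
exists e => x Ux; apply: ratio_eq => // D tD.
rewrite (eE x D Logic.I tD) mulr_suml; apply: eq_bigr => i _.
by rewrite -mulrA -(ratioP (ps i) Ux tD).
Qed.

(** The coefficients of the reference form in the basis give a linear form [e] on projective space,
    which is 1 on the vector of ratios because w_0 / w_0 = 1. *)
Lemma base_form_exists : exists e : 'cV[C]_N.+1,
  forall x, U x -> ((\row_i ratio (s i) x) *m e) 0 0 = 1.
Proof.
have [e eE] := ratio_lincomb (ew i0).1; exists e^T => x Ux.
rewrite -[RHS](ratio_eq (u := w i0) Ux) => [|D _]; last by rewrite mul1r.
by rewrite eE// mxE; apply: eq_bigr => i _; rewrite !mxE mulrC.
Qed.

Lemma canonical_point_exists : exists F : X -> PN,
  forall x, U x -> homog_coord (F x) (\row_i ratio (s i) x).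
Proof.
have [e eE] := base_form_exists.
suff /choice[F FE] : forall x, exists p : PN,
    U x -> homog_coord p (\row_i ratio (s i) x) by exists F.
move=> x.
have [Ux|nU] := pselect (U x); last first.
  have [|y _] := @homog_point_exists C 1 N (const_mx 1); last by exists y.
  by move=> j; apply/eqP => /rowP/(_ 0)/eqP; rewrite !mxE oner_eq0.
have [|y yE] := @homog_point_exists C 1 N (\row_i ratio (s i) x);
  last by exists y.
move=> j; apply/eqP => xj; have := eE x Ux; rewrite mxE big1 => [/esym/eqP|k _].
  by rewrite oner_eq0.
by have /rowP/(_ k) := xj; rewrite [LHS]mxE [RHS]mxE ord1 => ->; rewrite mul0r.
Qed.

Context {e : 'cV[C]_N.+1}.
Context (eE : forall x, U x -> ((\row_i ratio (s i) x) *m e) 0 0 = 1).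
Context {F : X -> PN}.
Context (FE : forall x, U x -> homog_coord (F x) (\row_i ratio (s i) x)).

Lemma canonical_map_point x : U x -> canonical_map s x (F x).
Proof.
move=> Ux; have [D [tD wD]] := V_nv i0 Ux; exists D; split=> //.
have -> : \row_i s i x D =
    \matrix_(j, k) (w i0 x D * (\row_i ratio (s i) x) j k).
  by apply/matrixP => j k; rewrite !mxE mulrC -(ratioP (sB.1 k)).
by apply: homog_coord_scale => //; exact: FE.
Qed.

Lemma e_neq0 x j : U x -> ((\row_i ratio (s i) x) *m e) j 0 != 0.
Proof. by move=> Ux; rewrite ord1 eE// oner_eq0. Qed.

Lemma canonical_lin_chart x : U x -> lin_chart e (F x).
Proof.
by move=> Ux; exists (\row_i ratio (s i) x); split=> [|j];
  [exact: FE|exact: e_neq0].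
Qed.

Lemma normal_canonical x : U x -> normal_coord e (F x) = \row_i ratio (s i) x.
Proof.
move=> Ux; rewrite (normal_coordE (FE Ux) (fun j => e_neq0 j Ux)).
by apply/matrixP => j k; rewrite mxE ord1 eE// divr1.
Qed.

(** Near the image of [x], [G] is pulled back from a regular function on projective space.
    Injectivity of [F] is not presupposed: it follows once the coordinates of U have this
    property. *)
Definition image_regular (x : X) (G : X -> C) : Prop :=
  exists W H, [/\ open W, W (F x), regularOn PN W H &
    forall y, U y -> W (F y) -> G y = H (F y)].

Lemma eq_image_regular x G G' : (forall y, U y -> G y = G' y) ->
  image_regular x G' -> image_regular x G.
Proof.
move=> GG' [W [H [oW Wx rH HE]]]; exists W, H; split=> // y Uy Wy.
by rewrite GG'// HE.
Qed.

Lemma image_regular_cst x a : image_regular x (fun=> a).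
Proof.
exists setT, (fun=> a); split=> //; first exact: openT.
by apply: (regular_cst ringPN); exact: openT.
Qed.

Lemma image_regularD x G G' : image_regular x G -> image_regular x G' ->
  image_regular x (fun y => G y + G' y).
Proof.
move=> [W [H [oW Wx rH HE]]] [W' [H' [oW' W'x rH' H'E]]].
have oWW := openI oW oW'.
exists (W `&` W'), (fun p => H p + H' p); split=> //.
  by apply: (regularD ringPN) => //; [apply: (regular_restrict oW oWW _ rH)|
    apply: (regular_restrict oW' oWW _ rH')] => p [].
by move=> y Uy [Wy W'y]; rewrite HE// H'E.
Qed.

Lemma image_regularM x G G' : image_regular x G -> image_regular x G' ->
  image_regular x (fun y => G y * G' y).
Proof.
move=> [W [H [oW Wx rH HE]]] [W' [H' [oW' W'x rH' H'E]]].
have oWW := openI oW oW'.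
exists (W `&` W'), (fun p => H p * H' p); split=> //.
  by apply: (regularM ringPN) => //; [apply: (regular_restrict oW oWW _ rH)|
    apply: (regular_restrict oW' oWW _ rH')] => p [].
by move=> y Uy [Wy W'y]; rewrite HE// H'E.
Qed.

Lemma image_regular_frac x P Q G : U x -> Q x != 0 ->
  image_regular x P -> image_regular x Q ->
  (forall y, U y -> Q y != 0 -> G y = P y / Q y) -> image_regular x G.
Proof.
move=> Ux Qx [W [H [oW Wx rH HE]]] [W' [H' [oW' W'x rH' H'E]]] GE.
have oD : open (W' `&` [set p | H' p != 0]) by exact: open_regular_neq0.
have oWD := openI oW oD.
exists (W `&` (W' `&` [set p | H' p != 0])), (fun p => H p * (H' p)^-1);
  split=> //.
- by split=> //; split=> //=; rewrite -H'E.
- apply: (regularM ringPN) => //.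
    by apply: (regular_restrict oW oWD _ rH) => p [].
  apply: (regularV ringPN) => //; last by move=> p [_ []].
  by apply: (regular_restrict oW' oWD _ rH') => p [_ []].
- move=> y Uy [Wy [W'y H'y]]; rewrite -HE// -H'E// GE//.
  by rewrite H'E.
Qed.

Lemma image_regular_sum x (J : Type) (l : seq J) (G : J -> X -> C) :
  (forall j, image_regular x (G j)) ->
  image_regular x (fun y => \sum_(j <- l) G j y).
Proof.
move=> rG; elim: l => [|j l IH].
  by apply: (eq_image_regular _ (image_regular_cst x 0)) => y _;
    rewrite big_nil.
by apply: (eq_image_regular _ (image_regularD (rG j) IH)) => y _;
  rewrite big_cons.
Qed.

Lemma image_regular_peval x (k : nat) (v : X -> 'rV[C]_k) P :
  (forall i, image_regular x (fun y => v y 0 i)) ->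
  image_regular x (fun y => peval P (v y)).
Proof.
move=> rv; elim/mpoly_ring_ind: P => [a|i|p q rp rq|p q rp rq].
- by apply: (eq_image_regular _ (image_regular_cst x a)) => y _;
    rewrite /peval mpoly.mevalC.
- by apply: (eq_image_regular _ (rv i)) => y _; rewrite /peval mpoly.mevalXU.
- by apply: (eq_image_regular _ (image_regularD rp rq)) => y _;
    rewrite /peval mpoly.mevalD.
- by apply: (eq_image_regular _ (image_regularM rp rq)) => y _;
    rewrite /peval mpoly.mevalM.
Qed.

Lemma image_regular_ratio x u : pluriform m setT u -> U x ->
  image_regular x (ratio u).
Proof.
move=> pu Ux; have [a aE] := ratio_lincomb pu.
apply: (eq_image_regular aE); apply: image_regular_sum => i.
apply: image_regularM; first exact: image_regular_cst.
exists (lin_chart e), (fun p => normal_coord e p 0 i); split.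
- exact: open_lin_chart.
- exact: canonical_lin_chart.
- exact: regular_normal_coord.
- by move=> y Uy _; rewrite normal_canonical// mxE.
Qed.

Lemma image_regular_coord x j k : U x ->
  image_regular x (fun y => normal_coord (first_form : 'cV[C]_2) (f y) j k).
Proof.
move=> Ux; have [->|k0] := eqVneq k 0.
  apply: (eq_image_regular _ (image_regular_cst x 1)) => y Uy.
  by have [_ /(_ j)] := normal_coordP (V_std Uy); rewrite first_formE.
have -> : k = 1 by case: k k0 => -[|[|//]] // ? _; apply/val_inj.
have [i [b [pb bE]]] := coord_ratio j.
apply: (@image_regular_frac x (ratio b) (ratio (w i))) => //.
- exact: ratio_neq0.
- exact: image_regular_ratio.
- exact: image_regular_ratio (ew i).1 Ux.
- move=> y Uy r0; have [D [tD wD]] := V_nv i0 Uy.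
  have := bE y D (V_std Uy) tD;
    rewrite (ratioP pb Uy tD) (ratioP (ew i).1 Uy tD).
  by rewrite mulrA => /(mulIf wD) ->; rewrite mulfK.
Qed.

Lemma image_regular_base x h : U x -> regularOn (P1n C n) V h ->
  image_regular x (fun y => h (f y)).
Proof.
move=> Ux rh; pose v y := mxvec (normal_coord (first_form : 'cV[C]_2) (f y)).
have vE y : U y -> multiproj_coord (f y) (v y).
  by move=> /V_std/normal_coordP[yA _]; rewrite /multiproj_coord mxvecK.
have rv i : image_regular x (fun y => v y 0 i).
  case: (mxvec_indexP i) => j k.
  by apply: (eq_image_regular _ (image_regular_coord j k Ux)) => y _;
    rewrite /v mxvecE.
have [p [q [qx hE]]] := rh (f x) (v x) Ux (vE x Ux).
apply: (@image_regular_frac x (fun y => peval p (v y)) (fun y =>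
  peval q (v y))) => //.
- exact: image_regular_peval.
- exact: image_regular_peval.
- by move=> y Uy qy; apply: (hE (f y)) => //; exact: vE.
Qed.

(** By [separating], the weights obtained from the constant one by
  multiplication
    with functions [chi i / chi i0 - a] include a multiple of the characteristic
    function of the identity. *)
Definition good_weight (a : gT -> C) : Prop :=
  forall G x, regularOn X U G -> U x ->
    image_regular x (fun y => \sum_g a g * G (act y g)).

Lemma regular_act G g : regularOn X U G -> regularOn X U (fun x => G (act x g)).
Proof.
move=> rG; have := morphism_setT_regular (act_morphism cover g) oU rG.
rewrite (_ : _ @^-1` _ = U)//.
by apply/seteqP; split=> x /=; rewrite (cover_act cover).
Qed.

Lemma good_weight1 : good_weight (fun=> 1).
Proof.
move=> G x rG Ux; have [||h [rh hE]] :=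
    regular_cover_descend (G := fun y => \sum_g 1 * G (act y g)) cover oV.
- apply: regular_sum => // g; apply: (regularM ringX) => //.
    exact: (regular_cst ringX).
  exact: regular_act.
- move=> y g Uy; rewrite [RHS](reindex_inj (mulgI g)) /=.
  by apply: eq_bigr => h _; rewrite action_mul.
by apply: (eq_image_regular hE); exact: image_regular_base.
Qed.

(** The hypothesis on [a] is applied to the product of [G] and [ratio (w i)]: translation by [g]
    multiplies the ratio by the quotient of characters, and the remaining factor, the ratio at [y],
    is divided out. *)
Lemma good_weight_chi i a c : good_weight a ->
  good_weight (fun g => (chi i g / chi i0 g - c) * a g).
Proof.
move=> ga G x rG Ux.
have ri := regular_ratio (ew i).1.
have r1 := ga _ x (regularM ringX oU ri rG) Ux.
have r2 := ga G x rG Ux.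
have r3 : image_regular x (fun y =>
    \sum_g (chi i g / chi i0 g) * a g * G (act y g)).
  apply: (image_regular_frac Ux (ratio_neq0 i Ux) r1 (image_regular_ratio (ew
    i).1 Ux)).
  move=> y Uy ry; rewrite mulr_suml; apply: eq_bigr => g _.
  rewrite ratio_act//; move: (ratio _ y) ry (chi i g / _) => r r0 z.
  by field.
have r4 := image_regularM (image_regular_cst x (- c)) r2.
apply: (eq_image_regular _ (image_regularD r3 r4)) => y _.
rewrite mulr_sumr -big_split; apply: eq_bigr => g _ /=.
by rewrite mulrBl mulrBl mulNr mulrA.
Qed.

Lemma image_regular_all G x : regularOn X U G -> U x -> image_regular x G.
Proof.
move=> rG Ux.
have /choice[i iE] : forall h : gT, exists i, h != 1%g -> chi i h != chi i0 h.
  move=> h; have [->|/eqP h1] := eqVneq h 1%g; first by exists i0.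
  by have [i ih] := separating h1; exists i.
pose rho h g := chi (i h) g / chi i0 g.
have gw (l : seq gT) : good_weight (fun g =>
  \prod_(h <- l) (rho h g - rho h h)).
  elim: l => [|h l IH].
    move=> G' y rG' Uy; apply: (eq_image_regular _ (good_weight1 rG' Uy)) =>
      z _.
    by apply: eq_bigr => g _; rewrite big_nil.
  move=> G' y rG' Uy.
  apply: (eq_image_regular _ (good_weight_chi (i h) (rho h h) IH rG' Uy)) =>
    z _.
  by apply: eq_bigr => g _; rewrite big_cons.
(* For g other than 1 the factor with h = g vanishes. At 1 each factor is 1 - rho h h, non-zero by
   the choice of [i h]. *)
pose a g := \prod_(h <- [seq h <- enum gT | h != 1%g]) (rho h g - rho h h).
have a0 g : g != 1%g -> a g = 0.
  move=> g1; rewrite /a (big_rem g) /=; first by rewrite subrr mul0r.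
  by rewrite mem_filter g1 mem_enum.
have a1 : a 1%g != 0.
  rewrite /a prodf_seq_neq0; apply/allP => h; rewrite mem_filter => /andP[h1 _].
  rewrite /= subr_eq0 /rho !chi1 divr1 eq_sym; apply: contra_neq (iE h h1) => E.
  by rewrite -[LHS](divfK (chi_neq0 i0 h)) E mul1r.
have ga : image_regular x (fun y => \sum_g a g * G (act y g)) by exact: gw.
apply: (eq_image_regular _ (image_regularM (image_regular_cst x (a 1%g)^-1)
  ga)) => y _.
rewrite (bigD1 1%g)//= big1 => [|g g1]; last by rewrite a0// mul0r.
by rewrite addr0 action1 mulKf.
Qed.

(** * The inverse on the image *)

Context {M : nat} {phi : X -> 'rV[C]_M} (c : chart U phi).

Lemma canonical_inj x y : U x -> U y -> F x = F y -> x = y.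
Proof.
move=> Ux Uy Fxy; apply: (chart_inj c) => //; apply/rowP => k.
have [W [H [_ Wx _ HE]]] := image_regular_all (chart_coord k c) Ux.
by rewrite (HE x)// (HE y)// -?Fxy.
Qed.

Lemma canonical_morphism : morphism_on U F.
Proof.
apply: (morphism_to_multiproj (O := U) (A := fun x => \row_i ratio (s i) x)) =>
  // i k.
by apply: (eq_regular oU _ (regular_ratio (sB.1 k))) => x _; rewrite mxE.
Qed.

Lemma image_regular_poly x P : U x -> image_regular x (fun y =>
  peval P (phi y)).
Proof.
move=> Ux; apply: image_regular_peval => k.
exact: image_regular_all (chart_coord k c) Ux.
Qed.

Lemma inverse_morphism (g : PN -> X) : (forall x, U x -> g (F x) = x) ->
  morphism_on (F @` U) g.
Proof.
move=> gF; split.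
  apply: within_continuousI => W _ oW [x Ux <-]; rewrite gF// => Wx.
  (* [Q] cuts out a neighbourhood of [x] inside [W]; extending it to a function near [F x] gives the
     neighbourhood in projective space. *)
  have [P [Q [Qx QE]]] := chart_regular c oW (regular_cst ringX 0 oW) Ux Wx.
  have [W' [H [oW' W'x rH HE]]] := image_regular_poly Q Ux.
  exists (W' `&` [set q | H q != 0]); split.
  - exact: open_regular_neq0.
  - by split=> //=; rewrite -HE.
  - move=> _ [y Uy <-] [W'y]; rewrite /= -HE// gF// => Qy.
    by have [] := QE y Uy Qy.
move=> W h oW rh _ [[x Ux <-]] /=; rewrite gF// => Wx.
have [P [Q [Qx QE]]] := chart_regular c oW rh Ux Wx.
have [W' [H [oW' W'x rH HE]]] : image_regular x h.
  apply: (image_regular_frac Ux Qx (image_regular_poly P Ux)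
    (image_regular_poly Q Ux)).
  by move=> y Uy Qy; exact: (QE y Uy Qy).2.
exists W', H; split=> // _ [[y Uy <-] _] W'y /=.
by rewrite gF// HE.
Qed.

(** The image of U is closed in the union of these sets. Staying in the chart of [e] keeps the
    normalized coordinates regular on [W]. *)
Definition extends_coord (W : set PN) : Prop :=
  [/\ open W, W `<=` lin_chart e & exists H : 'I_M -> PN -> C,
    (forall k, regularOn PN W (H k)) /\
    forall y, U y -> W (F y) -> phi y = \row_k H k (F y)].

Lemma extends_coord_image x : U x -> exists2 W, extends_coord W & W (F x).
Proof.
move=> Ux; have /choice[WH WHE] : forall k, exists WH : set PN * (PN -> C),
    [/\ open WH.1, WH.1 (F x), regularOn PN WH.1 WH.2 &
      forall y, U y -> WH.1 (F y) -> phi y 0 k = WH.2 (F y)].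
  move=> k; have [W [H h]] := image_regular_all (chart_coord k c) Ux.
  by exists (W, H).
have oL : open (lin_chart e : set PN) := @open_lin_chart _ _ _ _.
have oW : open (lin_chart e `&` [set q : PN | forall k, (WH k).1 q]).
  by apply: openI => //; apply: finite_open_bigcap => k; have [] := WHE k.
exists (lin_chart e `&` [set q | forall k, (WH k).1 q]).
  split; [exact: oW | by move=> q [] |].
  exists (fun k => (WH k).2); split=> [k|y Uy [_ Wy]].
    have [oWk _ rH _] := WHE k.
    by apply: (regular_restrict oWk oW _ rH) => q [_ /(_ k)].
  by apply/rowP => k; rewrite mxE; have [_ _ _ ->] := WHE k => //; exact: Wy.
split; first exact: canonical_lin_chart.
by move=> k; have [] := WHE k.
Qed.

(** Identities between regular functions along the image persist at [p]. Hence the extended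
    coordinates [z p] satisfy the equations of U and belong to some [x], and the normalized
    coordinates of [p] agree with the ratios at [x]. *)
Lemma extends_coord_closure (W : set PN) p : extends_coord W -> W p ->
  closure (F @` U) p -> (F @` U) p.
Proof.
move=> [oW WL [H [rH HE]]] Wp clp.
pose z q := \row_k H k q.
have rz P : regularOn PN W (fun q => peval P (z q)).
  apply: (regular_peval ringPN) => // k.
  by apply: (eq_regular oW _ (rH k)) => q _; rewrite mxE.
have [x Ux xz] : exists2 x, U x & phi x = z p.
  apply: contrapT => no; have [|P [Pz PE]] := chart_closed c (v := z p).
    by move=> x Ux xz; apply: no; exists x.
  move/negP: Pz; apply; apply/eqP.
  apply: (regular_closure_eq0 ringPN oW (rz P) clp Wp) => _ [y Uy <-] Wy.
  by rewrite /z -HE// PE.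
exists x => //.
suff nE : normal_coord e p = \row_i ratio (s i) x.
  have [pn _] := normal_coordP (WL p Wp).
  by apply: (homog_coord_inj (FE Ux)); rewrite -nE.
apply/matrixP => j i; rewrite ord1 [RHS]mxE.
(* Each ratio is a fraction P / Q in the chart coordinates; cleared of denominators, this is an
   identity between regular functions near [p]. *)
have [P [Q [Qx QE]]] := chart_regular c oU (regular_ratio (sB.1 i)) Ux Ux.
rewrite (QE x Ux Qx).2.
have oD : open (W `&` [set q | peval Q (z q) != 0]) by exact: open_regular_neq0.
have rD h : regularOn PN W h ->
  regularOn PN (W `&` [set q | peval Q (z q) != 0]) h.
  by move=> rh; apply: (regular_restrict oW oD _ rh) => q [].
have rn : regularOn PN W (fun q => normal_coord e q 0 i).
  by apply: (regular_restrict _ oW WL (regular_normal_coord 0 i));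
    exact: open_lin_chart.
suff E : normal_coord e p 0 i * peval Q (z p) + (-1) * peval P (z p) = 0.
  move/eqP: E; rewrite mulN1r subr_eq0 -xz => /eqP E.
  by apply: (mulIf Qx); rewrite divfK.
apply: (@regular_closure_eq0 _ PN ringPN (F @` U) _
  (fun q => normal_coord e q 0 i * peval Q (z q) + (-1) * peval P (z q)) p oD)
    => //.
- apply: (regularD ringPN) => //; first by apply: (regularM ringPN) => //;
    exact: rD.
  apply: (regularM ringPN) => //; last exact: rD.
  exact: (regular_cst ringPN).
- by split=> //=; rewrite -xz.
- move=> _ [y Uy <-] [Wy] /=; rewrite /z -HE// => Qy.
  by rewrite normal_canonical// mxE (QE y Uy Qy).2 divfK// mulN1r subrr.
Qed.

Lemma canonical_birational : V !=set0 ->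
  birational_onto_image (canonical_map s).
Proof.
move=> V0; have [x0 Ux0] : U !=set0.
  have [y Vy] := V0; case: cover => _ _ _ [_ _ [surj _ _ _]].
  by have [x xy] := surj y; exists x; rewrite /= xy.
exists U, F, (\bigcup_(W in extends_coord) W); split=> //.
- exact: dense_cover_preimage cover _ oV V0.
- exact: canonical_map_point.
split.
- by apply: bigcup_open => W [].
- apply/seteqP; split=> [_ [x Ux <-]|p [clp [W eW Wp]]].
    split; first by apply: subset_closure; exists x.
    by have [W eW Wx] := extends_coord_image Ux; exists W.
  exact: extends_coord_closure eW Wp clp.
have /choice[g gE] : forall p, exists x, (F @` U) p -> U x /\ F x = p.
  move=> p; have [[x Ux xp]|no] := pselect ((F @` U) p); last by exists x0.
  by exists x.
have gF x : U x -> g (F x) = x.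
  move=> Ux; have [|Ug Fg] := gE (F x); first by exists x.
  exact: canonical_inj.
exists g; split.
- by move=> x Ux; split; [exists x|exact: gF].
- by move=> p /gE[].
- exact: canonical_morphism.
- exact: inverse_morphism.
Qed.
End CanonicalMap.

(** * Choice of the eigenforms and conclusion *)

Theorem canonical_map_birational_abelian_cover (C : numClosedFieldType) (n :
  nat)
  (gT : finGroupType) (X : funspace C) (act : {action gT &-> X})
  (f : X -> P1n C n) (d m : nat) (chim : gT -> C)
  (r : (gT -> C) -> 'I_n -> int) :
  variety X -> smooth X d -> finite_abelian_cover act f -> (0 < m)%N ->
  canonical_character act d m chim ->
  (forall chi, irr_char chi -> eigensheaf_is_O act f d m chi (r chi)) ->
  (forall h : gT, h <> 1%g -> exists chi chi' : gT -> C,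
     [/\ irr_constituent chim chi,
       irr_constituent chim chi' & chi h <> chi' h]) ->
  (forall j, exists chi, irr_constituent chim chi /\ 1 <= r chi j) ->
  canonical_map_birational X d m.
Proof.
move=> [_ affX _] smX cover m_gt0 chimE rE condA condB.
have ringX := locally_affine_ringed affX.
have dimX (x : X) : tangent_dim x d by have [] := smX x.
have abG : abelian [set: gT]%SET by case: cover.
pose good (chi : gT -> C) (w : form X d) := [/\ irr_char chi,
  eigenform act m chi w & exists x, nonvanishing w x].
have constituent_good chi : irr_constituent chim chi -> exists w, good chi w.
  move=> chiC; have [w [ew nw]] :=
    constituent_eigenform m_gt0 ringX dimX affX abG chimE chiC.
  by exists w; split=> //; have [] := chiC.
have ge0 chi : irr_constituent chim chi -> forall j, 0 <= r chi j.
  move=> /constituent_good[w [irr ew [x nx]]] j; have [phi iso] := rE chi irr.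
  exact: (eigenform_degree_ge0 iso ew nx).
have monomials chi : irr_char chi -> (forall j, 0 <= r chi j) ->
    exists a, good chi a /\ forall j, 1 <= r chi j -> exists b : form X d,
      pluriform m setT b /\ forall x D, std_chart (f x) ->
        (forall i, tangent x (D i)) ->
        b x D = normal_coord (first_form : 'cV[C]_2) (f x) j 1 * a x D.
  move=> irr r0; have [phi iso] := rE chi irr.
  by have [a [ea na ab]] := eigenform_monomials iso r0; exists a.
have [chi0 [w0 good0]] : exists chi w, good chi w.
  have [chi [irr r0]] : exists chi, irr_char chi /\ forall j, 0 <= r chi j.
    (* For n = 0 the degree condition is empty and the trivial character serves; otherwise (b)
       supplies a character. *)
    case: {+}n r ge0 condB {f cover rE monomials} => [|k] r ge0 condB.
      by exists (fun=> 1); split; [exact: trivial_irr_char|case].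
    have [chi [chiC _]] := condB ord0.
    by exists chi; split; [have [] := chiC|exact: ge0].
  by have [a [ga _]] := monomials chi irr r0; exists chi, a.
have /choice[wB wBE] : forall j, exists cw : (gT -> C) * form X d,
    good cw.1 cw.2 /\ exists b : form X d, pluriform m setT b /\
      forall x D, std_chart (f x) -> (forall i, tangent x (D i)) ->
        b x D = normal_coord (first_form : 'cV[C]_2) (f x) j 1 * cw.2 x D.
  move=> j; have [chi [chiC rj]] := condB j.
  have [a [ga ab]] := monomials chi chiC.1 (ge0 chi chiC).
  by exists (chi, a); split=> //; exact: ab.
have /choice[wA wAE] : forall h : gT, exists cw : (gT -> C) * form X d,
    good cw.1 cw.2 /\ (h <> 1%g -> cw.1 h != chi0 h).
  move=> h; have [->|/eqP h1] := eqVneq h 1%g; first by exists (chi0, w0);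
    split.
  have [chi [chi' [chiC chiC' neq]]] := condA h h1.
  (* As [chi] and [chi'] differ at [h], at least one of them differs there from the reference
     [chi0]. *)
  have [E|chih] := eqVneq (chi h) (chi0 h).
    have [w gw] := constituent_good _ chiC'; exists (chi', w); split=> //= _.
    by apply/eqP => E'; apply: neq; rewrite E E'.
  by have [w gw] := constituent_good _ chiC; exists (chi, w).
(* A single finite family of all forms to be invertible on U: the reference, one for each coordinate
   and one for each group element. *)
pose cw (i : option ('I_n + gT)) := match i with
  | None => (chi0, w0) | Some (inl j) => wB j | Some (inr h) => wA h end.
have cwE i : good (cw i).1 (cw i).2.
  by case: i => [[j|h]|] //=; [have [] := wBE j|have [] := wAE h].
have ew i : eigenform act m (cw i).1 (cw i).2 by have [] := cwE i.
have nw i : exists x, nonvanishing (cw i).2 x by have [] := cwE i.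
have chi1 i : (cw i).1 1%g = 1.
  by have [irr _ _] := cwE i; have [] := irr_char_linear abG irr.
have chi_neq0 i g : (cw i).1 g != 0.
  have [irr _ _] := cwE i; have [_ chiM] := irr_char_linear abG irr.
  apply/eqP => E; have := chiM g g^-1%g.
  by rewrite mulgV chi1 E mul0r => /eqP; rewrite oner_eq0.
have [V [oV V0 V_std affV V_nv]] :=
  cover_affine_open m_gt0 ringX dimX affX cover ew chi_neq0 nw.
have [N [s [rG [sB _ _]]]] := chimE.
(* With an empty basis every pluricanonical form would be zero, contrary to the existence of the
   reference eigenform. *)
case: N s rG sB => [|N] s rG sB.
  have [x [D [tD]]] := nw None; have [_ s_gen] := sB.
  have [e [eE _]] := s_gen _ (ew None).1.
  by rewrite eE// big_ord0 eqxx.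
exists N, s; split=> //.
have coord_ratio j : exists i (b : form X d), pluriform m setT b /\
  forall x D, std_chart (f x) -> (forall i, tangent x (D i)) ->
    b x D = normal_coord (first_form : 'cV[C]_2) (f x) j 1 * (cw i).2 x D.
  by exists (Some (inl j)); have [_ [b h]] := wBE j; exists b.
have separating h : h <> 1%g -> exists i, (cw i).1 h != (cw None).1 h.
  by move=> h1; exists (Some (inr h)); have [_ /(_ h1)] := wAE h.
have [e eE] := base_form_exists m_gt0 ringX dimX affX sB None ew V_nv.
have [F FE] := canonical_point_exists m_gt0 ringX dimX affX sB None ew V_nv.
have [M [phi c]] := affine_chart (open_cover_preimage cover oV) affV.
exact: (canonical_birational m_gt0 ringX dimX affX cover sB ew chi_neq0 chi1
  oV V_std V_nv coord_ratio separating eE FE c V0).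
Qed.

Theorem corollary4p8 (R : realType) (n : nat) (gT : finGroupType)
  (X : funspace R[i]) (act : {action gT &-> X}) (pi : X -> P1n R[i] n)
  (d m : nat) (chim : gT -> R[i]) (r : (gT -> R[i]) -> 'I_n -> int)
  (X_variety : variety X) (X_smooth : smooth X d)
  (pi_cover : finite_abelian_cover act pi)
  (m_ge1 : (1 <= m)%N)
  (chimE : canonical_character act d m chim)
  (rE : forall chi : gT -> R[i], irr_char chi ->
     eigensheaf_is_O act pi d m chi (r chi))
  (condA : forall h : gT, h <> 1%g -> exists chi chi' : gT -> R[i],
     [/\ irr_constituent chim chi, irr_constituent chim chi' &
         chi h <> chi' h])
  (condB : forall j : 'I_n, exists chi : gT -> R[i],
     irr_constituent chim chi /\ 1 <= r chi j) :
  canonical_map_birational X d m.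
Proof.
exact: (canonical_map_birational_abelian_cover X_variety X_smooth pi_cover
  m_ge1 chimE rE condA condB).
Qed.
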